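(* The isometry classes $\{\mu\in\mathcal{B}: X_\mu$ has $P\}$, for $P$ each of LD2P, SD2P, DLD2P, DD2P and the Daugavet property, are all $G_\delta$-complete in $\mathcal{B}$.
   Context: $V$ is the set of finitely supported rational sequences; $\mathcal{P}\subset\mathbb{R}^V$ the seminorms on $V$ with pointwise convergence topology; for $\mu\in\mathcal{P}$, $\bar\mu$ is its seminorm extension to $c_{00}$ and $X_\mu$ the completion of $c_{00}/\{\bar\mu=0\}$; $\mathcal{B}$ is the set of $\mu\in\mathcal{P}$ with $X_\mu$ infinite-dimensional and $\bar\mu$ a norm on $c_{00}$, with the subspace topology. A set $A$ in a Polish space $Z$ is $G_\delta$-complete if it is $G_\delta$ and every $G_\delta$ subset of every zero-dimensional Polish space is a continuous preimage of $A$. A slice of $B_X$ is $S(B_X,f,\alpha)=\{x\in B_X:f(x)>1-\alpha\}$, $f\in S_{X^*}$, $\alpha>0$. LD2P: every slice of $B_X$ has diameter 2. SD2P: every convex combination of slices of $B_X$ has diameter 2. DLD2P: for every $\varepsilon>0$, slice $S$ and $x\in S\cap S_X$ there is $y\in S$ with $\|x-y\|>2-\varepsilon$. DD2P: for every $\varepsilon>0$, nonempty relatively weakly open $U\subset B_X$ and $x\in U\cap S_X$ there is $y\in U$ with $\|x-y\|>2-\varepsilon$. Daugavet property: for every $\varepsilon>0$, $x\in S_X$ and slice $S$ there is $y\in S$ with $\|x-y\|>2-\varepsilon$. *)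

(* Defs.v *)
From HB Require Import structures.
From mathcomp Require Import all_boot all_order all_algebra.
From mathcomp Require Import all_classical all_reals all_analysis.
From mathcomp Require Import Rstruct Rstruct_topology borel_hierarchy.
Set Implicit Arguments. Unset Strict Implicit. Unset Printing Implicit Defensive.
Import Order.TTheory GRing.Theory Num.Theory.
Import numFieldNormedType.Exports.
Local Open Scope classical_set_scope.
Local Open Scope ring_scope.

Notation RR := Rdefinitions.R.

Definition fin_supp {K : zmodType} (x : nat -> K) : Prop :=
  exists N, forall n, (N <= n)%N -> x n = 0.

Definition V := {x : nat -> rat | fin_supp x}.
Definition c00 := {x : nat -> RR | fin_supp x}.

Definition seminorm_V (mu : V -> RR) : Prop :=
  (forall x y z : V, (forall n, proj1_sig z n = proj1_sig x n + proj1_sig y n) ->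
     mu z <= mu x + mu y) /\
  (forall (q : rat) (x z : V), (forall n, proj1_sig z n = q * proj1_sig x n) ->
     mu z = `|ratr q| * mu x).

Definition seminorm_c00 (nu : c00 -> RR) : Prop :=
  (forall x y z : c00, (forall n, proj1_sig z n = proj1_sig x n + proj1_sig y n) ->
     nu z <= nu x + nu y) /\
  (forall (a : RR) (x z : c00), (forall n, proj1_sig z n = a * proj1_sig x n) ->
     nu z = `|a| * nu x).

Definition RV := {ptws V -> RR}.
Definition Pset : set RV := [set mu | seminorm_V mu].

(** nu is the seminorm extension of mu to c00 (it is unique) *)
Definition bar_ext (mu : V -> RR) (nu : c00 -> RR) : Prop :=
  seminorm_c00 nu /\
  (forall (v : V) (x : c00), (forall n, proj1_sig x n = ratr (proj1_sig v n)) -> nu x = mu v).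

(** X together with T is (a copy of) the completion of c00/{nu = 0}:
    T : c00 -> X linear, ||T x|| = nu x, with dense range in the Banach space X *)
Definition completion_of (nu : c00 -> RR) (X : completeNormedModType RR) (T : c00 -> X) : Prop :=
  (forall x y z : c00, (forall n, proj1_sig z n = proj1_sig x n + proj1_sig y n) ->
     T z = T x + T y) /\
  (forall (a : RR) (x z : c00), (forall n, proj1_sig z n = a * proj1_sig x n) ->
     T z = a *: T x) /\
  (forall x, `|T x| = nu x) /\
  dense (range T).

Definition X_has (mu : V -> RR) (Pr : normedModType RR -> Prop) : Prop :=
  forall nu, bar_ext mu nu ->
  forall (X : completeNormedModType RR) (T : c00 -> X), completion_of nu T -> Pr X.

Definition infinite_dim (X : normedModType RR) : Prop :=
  forall (n : nat) (v : 'I_n -> X), exists x : X,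
    forall c : 'I_n -> RR, x <> \sum_(i < n) c i *: v i.

Definition is_norm_c00 (nu : c00 -> RR) : Prop :=
  forall x : c00, nu x = 0 -> forall n, proj1_sig x n = 0.

Definition Bset : set RV :=
  [set mu | Pset mu /\ X_has mu infinite_dim /\ (forall nu, bar_ext mu nu -> is_norm_c00 nu)].

Section BanachNotions.
Variable X : normedModType RR.

Definition unit_ball : set X := [set x | `|x| <= 1].
Definition unit_sphere : set X := [set x | `|x| = 1].

Definition lin_fun (f : X -> RR) : Prop := forall (a : RR) (x y : X), f (a *: x + y) = a * f x + f y.

Definition dual_elt (f : X -> RR) : Prop := lin_fun f /\ continuous f.

Definition dual_sphere (f : X -> RR) : Prop :=
  lin_fun f /\ ereal_sup [set (`|f x|)%:E | x in unit_ball] = 1%:E.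

Definition slice (f : X -> RR) (a : RR) : set X := [set x | unit_ball x /\ 1 - a < f x].

Definition is_slice (S : set X) : Prop :=
  exists f a, dual_sphere f /\ 0 < a /\ S = slice f a.

Definition diam (S : set X) : \bar RR := ereal_sup [set (`|x - y|)%:E | x in S & y in S].

Definition weakly_open (W : set X) : Prop :=
  forall w, W w -> exists (n : nat) (g : 'I_n -> X -> RR) (d : RR),
    (forall i, dual_elt (g i)) /\ 0 < d /\ [set z | forall i, `|g i (z - w)| < d] `<=` W.

Definition rel_weakly_open (U : set X) : Prop :=
  exists W, weakly_open W /\ U = unit_ball `&` W.

End BanachNotions.

Definition LD2P (X : normedModType RR) : Prop :=
  forall S : set X, is_slice S -> diam S = 2%:E.

Definition SD2P (X : normedModType RR) : Prop :=
  forall (n : nat) (S : 'I_n.+1 -> set X) (lam : 'I_n.+1 -> RR),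
    (forall i, is_slice (S i)) -> (forall i, 0 < lam i) -> \sum_(i < n.+1) lam i = 1 ->
    diam [set z | exists x : 'I_n.+1 -> X, (forall i, S i (x i)) /\ z = \sum_(i < n.+1) lam i *: x i]
      = 2%:E.

Definition DLD2P (X : normedModType RR) : Prop :=
  forall e : RR, 0 < e -> forall S : set X, is_slice S ->
  forall x, S x -> unit_sphere x -> exists y, S y /\ 2 - e < `|x - y|.

Definition DD2P (X : normedModType RR) : Prop :=
  forall e : RR, 0 < e -> forall U : set X, rel_weakly_open U -> U !=set0 ->
  forall x, U x -> unit_sphere x -> exists y, U y /\ 2 - e < `|x - y|.

Definition Daugavet (X : normedModType RR) : Prop :=
  forall e : RR, 0 < e -> forall x : X, unit_sphere x -> forall S : set X, is_slice S ->
  exists y, S y /\ 2 - e < `|x - y|.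

Definition polish (Y : topologicalType) : Prop :=
  exists d : Y -> Y -> RR,
    (forall x y, 0 <= d x y) /\ (forall x y, d x y = 0 <-> x = y) /\
    (forall x y, d x y = d y x) /\ (forall x y z, d x z <= d x y + d y z) /\
    (forall U : set Y, open U <-> forall x, U x -> exists2 e : RR, 0 < e & [set y | d x y < e] `<=` U) /\
    (forall u : nat -> Y,
       (forall e : RR, 0 < e -> exists N, forall m n, (N <= m)%N -> (N <= n)%N -> d (u m) (u n) < e) ->
       exists l : Y, u @ \oo --> l) /\
    (exists D : set Y, countable D /\ dense D).

Definition zero_dim (Y : topologicalType) : Prop :=
  forall (x : Y) (N : set Y), nbhs x N -> exists U, clopen U /\ U x /\ U `<=` N.

Definition Gdelta_complete (Z : topologicalType) (B A : set Z) : Prop :=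
  (exists G : set Z, Gdelta G /\ A = B `&` G) /\
  (forall Y : topologicalType, polish Y -> zero_dim Y ->
   forall C : set Y, Gdelta C ->
   exists f : Y -> Z, continuous f /\ (forall y, B (f y)) /\ C = f @^-1` A).

Definition iso_class (Pr : normedModType RR -> Prop) : set RV :=
  [set mu | Bset mu /\ X_has mu Pr].

(* Main.v *)
(** For a space [X] with a countable dense set indexed by [V], each of the five
    properties says that for all functionals [f_1, ..., f_n] in the unit ball of
    the dual there are vectors satisfying finitely many strict inequalities. The
    dual ball is compact (every functional dominated by [mu] is [t * mu] with [t]
    in a cube independent of [mu]), so each such condition, for fixed rational
    data, is open in [mu]; countably many of them define the class.

    For the hardness, [mu_y] is the norm of [L_1(m_y)] on the step functions on
    the 2-adic integers, where the measure [m_y] depends continuously on [y], is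
    positive on every residue class, and has an atom (at [0]) exactly when [y] is
    outside the given G_delta set. Without atoms, vectors can be concentrated on
    sets of tiny measure while finitely many functionals are almost preserved,
    which yields all five properties; an atom produces slices of the unit ball of
    small diameter, which rules all of them out. *)
Require Import Defs.
From HB Require Import structures.
From mathcomp Require Import all_boot all_order all_algebra.
From mathcomp Require Import all_classical all_reals all_analysis.
From mathcomp Require Import Rstruct Rstruct_topology borel_hierarchy.
From mathcomp Require Import ring lra.
Set Implicit Arguments. Unset Strict Implicit. Unset Printing Implicit Defensive.
Import Order.TTheory GRing.Theory Num.Theory.
Import numFieldNormedType.Exports.
Local Open Scope classical_set_scope.
Local Open Scope ring_scope.

(* Otherwise rewriting with multiplicative lemmas unfolds [ratr q] to a quotient. *)
#[local] Opaque ratr.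

(** * Rational sequences, seminorms and dense models *)

(** The five properties reduce to two shapes on [V]: [far_cond] for DLD2P, DD2P and Daugavet,
    [ccs_cond] for LD2P and SD2P. The obstacle is that slices speak of unit vectors and of
    functionals of norm exactly one, and neither notion is stable when [mu] moves: a unit vector for
    one seminorm is not one for the next, and the dual sphere is not weak* compact. So functionals
    range over the whole dual ball, and vectors are not normalized but compared through homogeneous
    strict inequalities. The two shapes share a sufficient condition, [concentrated], and an
    obstruction, [peaked], so a single reduction serves all five classes. It encodes a G_delta set
    as the set where an increasing sequence of continuous functions diverges; after a correction
    making this sequence positive and strictly increasing, the class of 0 mod [2 ^ N] receives the
    reciprocal of its N-th term as mass, and the atom vanishes exactly where the sequence
    diverges. *)

Section FinitelySupported.
Variable K : nzRingType.

Definition fsseq := {x : nat -> K | fin_supp x}.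

Lemma fsseq_eq (x y : fsseq) : proj1_sig x =1 proj1_sig y -> x = y.
Proof.
case: x y => [x hx] [y hy] /= /funext exy; subst y.
by rewrite (Prop_irrelevance hx hy).
Qed.

Lemma fin_supp0 : fin_supp (fun _ : nat => 0 : K).
Proof. by exists 0%N. Qed.

Lemma fin_suppD (x y : fsseq) :
  fin_supp (fun n => proj1_sig x n + proj1_sig y n).
Proof.
case: x y => [x [N hN]] [y [M hM]]; exists (maxn N M) => n /=.
by rewrite geq_max => /andP[/hN -> /hM ->]; rewrite addr0.
Qed.

Lemma fin_suppN (x : fsseq) : fin_supp (fun n => - proj1_sig x n).
Proof. by case: x => [x [N hN]]; exists N => n /hN /= ->; rewrite oppr0. Qed.

Lemma fin_suppZ (a : K) (x : fsseq) : fin_supp (fun n => a * proj1_sig x n).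
Proof. by case: x => [x [N hN]]; exists N => n /hN /= ->; rewrite mulr0. Qed.

Definition fs0 : fsseq := exist _ _ fin_supp0.
Definition fsD x y : fsseq := exist _ _ (fin_suppD x y).
Definition fsN x : fsseq := exist _ _ (fin_suppN x).
Definition fsZ a x : fsseq := exist _ _ (fin_suppZ a x).

HB.instance Definition _ := gen_eqMixin fsseq.
HB.instance Definition _ := gen_choiceMixin fsseq.

Fact fsDA : associative fsD.
Proof. by move=> x y z; apply: fsseq_eq => n /=; rewrite addrA. Qed.
Fact fsDC : commutative fsD.
Proof. by move=> x y; apply: fsseq_eq => n /=; rewrite addrC. Qed.
Fact fsD0 : left_id fs0 fsD.
Proof. by move=> x; apply: fsseq_eq => n /=; rewrite add0r. Qed.
Fact fsDN : left_inverse fs0 fsN fsD.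
Proof. by move=> x; apply: fsseq_eq => n /=; rewrite addNr. Qed.
HB.instance Definition _ := GRing.isZmodule.Build fsseq fsDA fsDC fsD0 fsDN.

Fact fsZA a b x : fsZ a (fsZ b x) = fsZ (a * b) x.
Proof. by apply: fsseq_eq => n /=; rewrite mulrA. Qed.
Fact fsZ1 : left_id 1 fsZ.
Proof. by move=> x; apply: fsseq_eq => n /=; rewrite mul1r. Qed.
Fact fsZDr : right_distributive fsZ +%R.
Proof. by move=> a x y; apply: fsseq_eq => n /=; rewrite mulrDr. Qed.
Fact fsZDl x : {morph fsZ^~ x : a b / a + b}.
Proof. by move=> a b; apply: fsseq_eq => n /=; rewrite mulrDl. Qed.
HB.instance Definition _ :=
  GRing.Zmodule_isLmodule.Build K fsseq fsZA fsZ1 fsZDr fsZDl.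

End FinitelySupported.

HB.instance Definition _ := GRing.Lmodule.copy V (fsseq rat).
HB.instance Definition _ := GRing.Lmodule.copy c00 (fsseq RR).

Lemma V_scaleE q (x : V) n : proj1_sig (q *: x) n = q * proj1_sig x n.
Proof. by []. Qed.
Lemma V_eq (x y : V) : proj1_sig x =1 proj1_sig y -> x = y.
Proof. exact: (@fsseq_eq rat). Qed.

Section Seminorms.
Variable mu : V -> RR.
Hypothesis muP : seminorm_V mu.

Lemma snD x y : mu (x + y) <= mu x + mu y.
Proof. exact: muP.1. Qed.

Lemma snZ q x : mu (q *: x) = `|ratr q| * mu x.
Proof. exact: muP.2. Qed.

Lemma sn0 : mu 0 = 0.
Proof. by rewrite -(scale0r 0) snZ rmorph0 normr0 mul0r. Qed.

Lemma snN x : mu (- x) = mu x.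
Proof. by rewrite -scaleN1r snZ rmorphN1 normrN1 mul1r. Qed.

Lemma sn_ge0 x : 0 <= mu x.
Proof. by have := snD x (- x); rewrite subrr sn0 snN; lra. Qed.
End Seminorms.

Lemma ratrD q r : ratr (q + r) = ratr q + ratr r :> RR.
Proof. exact: rmorphD. Qed.

Lemma ratrM q r : ratr (q * r) = ratr q * ratr r :> RR.
Proof. exact: rmorphM. Qed.

Lemma natinv_lt (e : RR) : 0 < e -> exists k : nat, k.+1%:R^-1 < e.
Proof.
move=> e0; have ei : 0 <= e^-1 by rewrite invr_ge0 ltW.
exists (Num.bound e^-1); rewrite -[ltRHS]invrK ltf_pV2 ?posrE ?invr_gt0 ?ltr0n //.
by apply: (lt_trans (archi_boundP ei)); rewrite ltr_nat.
Qed.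

Lemma ratr_approx (a e : RR) : 0 < e -> exists q : rat, `|a - ratr q| < e.
Proof.
move=> e0; have lt : a - e < a + e by lra.
have [q /=] := rat_in_itvoo lt; rewrite in_itv /= => /andP[h1 h2].
by exists q; rewrite ltr_norml; apply/andP; split; lra.
Qed.

Lemma ratr_approx_gt (a e : RR) : 0 < e -> exists q : rat, a < ratr q < a + e.
Proof.
move=> e0; have lt : a < a + e by lra.
by have [q /=] := rat_in_itvoo lt; rewrite in_itv /= => h; exists q.
Qed.

(** The absolute value around [mu x] only makes the definition meaningful on all
    of [RV]; it is immaterial when [mu] is a seminorm. *)
Definition dominated (mu f : V -> RR) : Prop :=
  (forall q x y, f (q *: x + y) = ratr q * f x + f y) /\
  (forall x, `|f x| <= `|mu x|).

Section Dominated.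
Variables (mu f : V -> RR).
Hypothesis muP : seminorm_V mu.
Hypothesis fP : dominated mu f.

Lemma domP q x y : f (q *: x + y) = ratr q * f x + f y.
Proof. exact: fP.1. Qed.

Lemma domD x y : f (x + y) = f x + f y.
Proof. by rewrite -{1}(scale1r x) domP rmorph1 mul1r. Qed.

Lemma dom0 : f 0 = 0.
Proof. by have := domD 0 0; rewrite addr0; lra. Qed.

Lemma domZ q x : f (q *: x) = ratr q * f x.
Proof. by rewrite -(addr0 (q *: x)) domP dom0 addr0. Qed.

Lemma domN x : f (- x) = - f x.
Proof. by rewrite -scaleN1r domZ rmorphN1 mulN1r. Qed.

Lemma domB x y : f (x - y) = f x - f y.
Proof. by rewrite domD domN. Qed.

Lemma dom_norm x : `|f x| <= mu x.
Proof. by rewrite -(ger0_norm (sn_ge0 muP x)); exact: fP.2. Qed.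

Lemma dom_le x : f x <= mu x.
Proof. exact: le_trans (ler_norm _) (dom_norm x). Qed.

Lemma dom_sum (I : Type) (r : seq I) (P : pred I) (F : I -> V) :
  f (\sum_(i <- r | P i) F i) = \sum_(i <- r | P i) f (F i).
Proof. by elim/big_rec2: _ => [|i y1 y2 _ <-]; rewrite ?dom0 ?domD. Qed.

Lemma domN_dominated : dominated mu (fun x => - f x).
Proof. by split=> [q x y|x]; rewrite ?domP ?normrN; [ring|exact: fP.2]. Qed.
End Dominated.

(** * Dense models of a Banach space over [V] *)

Section Model.
Variables (mu : V -> RR) (X : normedModType RR) (j : V -> X).

(** This is all that is retained of a completion: a rational-linear isometric copy of [(V, mu)] with
    dense range. The properties are transferred to [V] through it, so the particular completion does
    not matter. *)
Definition model : Prop :=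
  [/\ forall q x y, j (q *: x + y) = ratr q *: j x + j y,
      forall x, `|j x| = mu x &
      forall x e, 0 < e -> exists v, `|x - j v| < e].

Hypothesis jP : model.

Lemma mdlP q x y : j (q *: x + y) = ratr q *: j x + j y.
Proof. by case: jP. Qed.
Lemma mdl_norm x : `|j x| = mu x.
Proof. by case: jP. Qed.
Lemma mdl_dense x e : 0 < e -> exists v, `|x - j v| < e.
Proof. by case: jP => _ _; exact. Qed.

Lemma mdlD x y : j (x + y) = j x + j y.
Proof. by rewrite -{1}(scale1r x) mdlP rmorph1 scale1r. Qed.

Lemma mdl0 : j 0 = 0.
Proof. by apply: (addIr (j 0)); rewrite -mdlD !add0r. Qed.

Lemma mdlZ q x : j (q *: x) = ratr q *: j x.
Proof. by rewrite -(addr0 (q *: x)) mdlP mdl0 addr0. Qed.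

Lemma mdlN x : j (- x) = - j x.
Proof. by rewrite -scaleN1r mdlZ rmorphN1 scaleN1r. Qed.

Lemma mdlB x y : j (x - y) = j x - j y.
Proof. by rewrite mdlD mdlN. Qed.

Lemma mdl_sum (I : Type) (r : seq I) (P : pred I) (F : I -> V) :
  j (\sum_(i <- r | P i) F i) = \sum_(i <- r | P i) j (F i).
Proof. by elim/big_rec2: _ => [|i y1 y2 _ <-]; rewrite ?mdl0 ?mdlD. Qed.

Lemma mdl_seminorm : seminorm_V mu.
Proof.
split=> [x y z h|q x z h].
  have -> : z = x + y by apply: V_eq => n; rewrite h.
  by rewrite -!mdl_norm mdlD ler_normD.
have -> : z = q *: x by apply: V_eq => n; rewrite h.
by rewrite -!mdl_norm mdlZ normrZ.
Qed.

(** Scaling into the open ball before approximating gives the strict bound. *)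
Lemma mdl_approx_ball (x : X) r e : `|x| <= r -> 0 < r -> 0 < e ->
  exists2 v, mu v < r & `|x - j v| < e.
Proof.
move=> xr r0 e0; pose t := Num.min (1/2) (e / (2 * r)).
have t0 : 0 < t by rewrite lt_min divr_gt0 ?ltr01 ?ltr0n // divr_gt0 // mulr_gt0.
have t1 : t <= 1/2 by rewrite ge_min lexx.
have te : t * r <= e / 2.
  have : t <= e / (2 * r) by rewrite ge_min lexx orbT.
  by rewrite ler_pdivlMr ?mulr_gt0 //; lra.
have tr0 : 0 < t * r by rewrite mulr_gt0.
have [v hv] := mdl_dense ((1 - t) *: x) tr0.
exists v.
  rewrite -mdl_norm.
  have : `|j v| <= `|(1 - t) *: x - j v| + `|(1 - t) *: x|.
    by rewrite -[in leLHS](subKr ((1 - t) *: x) (j v)) (le_trans (ler_normB _ _)) // addrC.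
  rewrite normrZ ger0_norm; last by lra.
  have : (1 - t) * `|x| <= (1 - t) * r by rewrite ler_wpM2l //; lra.
  by move: hv; lra.
have -> : x - j v = t *: x + ((1 - t) *: x - j v).
  by rewrite scalerBl scale1r !addrA [t *: x + x]addrC addrK.
apply: (le_lt_trans (ler_normD _ _)); rewrite normrZ ger0_norm; last exact: ltW.
have : t * `|x| <= t * r by rewrite ler_wpM2l // ltW.
by lra.
Qed.

(** [F] is the McShane formula for a 1-Lipschitz extension. Its value at [x] is pinned down by the
    values of [f] near [x] ([FP]), so density turns the rational linearity of [f] into real
    linearity of [F]. *)
Lemma dominated_ext (f : V -> RR) : dominated mu f ->
  exists F : X -> RR, [/\ lin_fun F, forall x, `|F x| <= `|x| & forall v, F (j v) = f v].
Proof.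
move=> fP; have muP := mdl_seminorm.
have key (x : X) u v : f v - `|x - j v| <= f u + `|x - j u|.
  have := dom_le muP fP (v - u); rewrite (domB fP) -mdl_norm mdlB.
  have -> : j v - j u = (x - j u) - (x - j v).
    by rewrite opprB [RHS]addrC addrA subrK.
  by have := ler_normB (x - j u) (x - j v); lra.
pose F (x : X) := sup [set f v - `|x - j v| | v in setT].
have FP x v : `|F x - f v| <= `|x - j v|.
  have ne : [set f v - `|x - j v| | v in setT] !=set0 by exists (f 0 - `|x - j 0|); exists 0.
  have hub u : ubound [set f v - `|x - j v| | v in setT] (f u + `|x - j u|).
    by move=> _ [w _ <-]; exact: key.
  have h1 : F x <= f v + `|x - j v| by apply: ge_sup => //; exact: hub.
  have h2 : f v - `|x - j v| <= F x.
    by apply: ub_le_sup; [exists (f 0 + `|x - j 0|); exact: hub | exists v].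
  by rewrite ler_norml; apply/andP; split; lra.
have Fj v : F (j v) = f v.
  by apply/eqP; rewrite -subr_eq0 -normr_le0; have := FP (j v) v; rewrite subrr normr0.
exists F; split => //; last first.
  move=> x; apply/ler_addgt0Pr => e e0; have := FP x 0.
  by rewrite mdl0 (dom0 fP) !subr0; lra.
move=> a x y; apply/eqP; rewrite -subr_eq0 -normr_le0.
apply/ler_addgt0Pr => e e0; rewrite add0r.
(* The errors [e1] and [e2] below add up to at most [2 * d * (|x| + |a| + d + 1)]; since [d <= 1],
   this is covered by [d * C]. *)
pose C := 1 + 2 * `|x| + 2 * `|a| + 4.
have C0 : 0 < C by rewrite /C; have := normr_ge0 x; have := normr_ge0 a; lra.
pose d := Num.min 1 (e / C).
have d0 : 0 < d by rewrite lt_min ltr01 divr_gt0.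
have d1 : d <= 1 by rewrite ge_min lexx.
have dC : d * C <= e by rewrite -ler_pdivlMr // ge_min lexx orbT.
have [u hu] := mdl_dense x d0; have [w hw] := mdl_dense y d0.
have [q hq] := ratr_approx a d0.
have h1 := FP (a *: x + y) (q *: u + w); have h2 := FP x u; have h3 := FP y w.
rewrite (domP fP) mdlP in h1.
move: (ratr q) h1 hq => r h1 hq.
have hr : `|r| <= `|a| + d.
  by have := ler_normB a (a - r); rewrite subKr; move: hq; lra.
have e1 : `|a *: x + y - (r *: j u + j w)| <= d * `|x| + (`|a| + d) * d + d.
  have -> : a *: x + y - (r *: j u + j w) =
     (a - r) *: x + r *: (x - j u) + (y - j w).
    by rewrite scalerBl scalerBr [X in _ = X + _]addrA subrK opprD addrACA.
  apply: (le_trans (ler_normD _ _)); apply: lerD; last exact: ltW.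
  apply: (le_trans (ler_normD _ _)); rewrite !normrZ; apply: lerD.
    by rewrite ler_wpM2r // ltW.
  by apply: ler_pM => //; exact: ltW.
have e2 : `|r * f u + f w - (a * F x + F y)| <= d * `|x| + (`|a| + d) * d + d.
  have -> : r * f u + f w - (a * F x + F y) =
     (r - a) * F x + r * (f u - F x) + (f w - F y) by ring.
  apply: (le_trans (ler_normD _ _)); apply: lerD; last by rewrite distrC; move: h3 hw; lra.
  apply: (le_trans (ler_normD _ _)); rewrite !normrM; apply: lerD.
    apply: ler_pM => //; first by rewrite distrC ltW.
    by have := FP x 0; rewrite mdl0 (dom0 fP) !subr0.
  by apply: ler_pM => //; rewrite distrC; apply/ltW/(le_lt_trans h2).
have := ler_normD (F (a *: x + y) - (r * f u + f w))
                  (r * f u + f w - (a * F x + F y)).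
have -> : F (a *: x + y) - (r * f u + f w) +
   (r * f u + f w - (a * F x + F y)) = F (a *: x + y) - (a * F x + F y) by ring.
have dd : d * d <= d * 1 by rewrite ler_wpM2l // ltW.
have : d * C = d + 2 * (d * `|x|) + 2 * (d * `|a|) + 4 * d by rewrite /C; ring.
have : (`|a| + d) * d = d * `|a| + d * d by ring.
by lra.
Qed.
End Model.

(** * Normal forms of the five properties *)

Lemma finite_pos_min (n : nat) (d : 'I_n -> RR) :
  (forall i, 0 < d i) -> exists2 e, 0 < e & forall i, e <= d i.
Proof.
move=> d0; have [e e0 he] : exists2 e : RR, 0 < e & forall i, i \in enum 'I_n -> e <= d i.
  elim: (enum 'I_n) => [|i s [e e0 he]]; first by exists 1.
  exists (Num.min e (d i)); first by rewrite lt_min e0 d0.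
  move=> k; rewrite inE ge_min => /orP[/eqP ->|/he ->//].
  by rewrite lexx orbT.
by exists e => // i; apply: he; rewrite mem_enum.
Qed.

Section LinearFunctionals.
Variable X : normedModType RR.

Section Basic.
Variable F : X -> RR.
Hypothesis FP : lin_fun F.

Lemma lin_funD x y : F (x + y) = F x + F y.
Proof. by rewrite -{1}(scale1r x) FP mul1r. Qed.

Lemma lin_fun0 : F 0 = 0.
Proof. by have := lin_funD 0 0; rewrite addr0; lra. Qed.

Lemma lin_funZ a x : F (a *: x) = a * F x.
Proof. by rewrite -(addr0 (a *: x)) FP lin_fun0 addr0. Qed.

Lemma lin_funN x : F (- x) = - F x.
Proof. by rewrite -scaleN1r lin_funZ mulN1r. Qed.

Lemma lin_funB x y : F (x - y) = F x - F y.
Proof. by rewrite lin_funD lin_funN. Qed.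

Lemma lin_fun_scale a : lin_fun (fun x => a * F x).
Proof. by move=> b x y; rewrite FP; ring. Qed.
End Basic.

Definition contractive (F : X -> RR) : Prop :=
  lin_fun F /\ forall x, `|F x| <= `|x|.

Lemma contractive_le F x : contractive F -> F x <= `|x|.
Proof. by move=> [_ h]; exact: le_trans (ler_norm _) (h x). Qed.

Lemma contractive_dist F x y : contractive F -> `|F x - F y| <= `|x - y|.
Proof. by move=> [l h]; rewrite -(lin_funB l). Qed.

Lemma contractive_dual_elt F : contractive F -> dual_elt F.
Proof.
move=> FP; split; first by case: FP.
suff : continuous (F : X -> (RR : realType)) by [].
move=> x; apply/cvgrPdist_lt => e e0.
apply/nbhs_ballP; exists e => //= y; rewrite -ball_normE /= => xy.
exact: le_lt_trans (contractive_dist x y FP) xy.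
Qed.

Lemma dual_elt_bounded g : dual_elt g ->
  exists2 M, 0 < M & contractive (fun x => M^-1 * g x).
Proof.
move=> [gl gc]; have := (gc : continuous (g : X -> (RR : realType))) 0.
rewrite /continuous_at (lin_fun0 gl) => /cvgrPdist_lt /(_ 1 ltr01).
move=> /nbhs_ballP[d /= d0 hd].
have gM x : `|g x| <= 2 / d * `|x|.
  have [->|x0] := eqVneq x 0; first by rewrite (lin_fun0 gl) !normr0 mulr0.
  have nx : 0 < `|x| by rewrite normr_gt0.
  pose t := d / (2 * `|x|).
  have t0 : 0 < t by rewrite divr_gt0 // mulr_gt0.
  have : `|0 - g (t *: x)| < 1.
    apply: hd; rewrite -ball_normE /= sub0r normrN normrZ gtr0_norm //.
    by rewrite /t invfM mulrA mulfVK ?gt_eqF //; lra.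
  rewrite sub0r normrN (lin_funZ gl) normrM gtr0_norm // => h.
  have -> : 2 / d * `|x| = t^-1 by rewrite /t invfM invrK; field; rewrite gt_eqF.
  by rewrite -[leRHS]mul1r ler_pdivlMr // mulrC ltW.
have M0 : 0 < 2 / d by rewrite divr_gt0.
exists (2 / d) => //; split; first exact: lin_fun_scale.
by move=> x; rewrite normrM gtr0_norm ?invr_gt0 // mulrC ler_pdivrMr // mulrC.
Qed.

Lemma dual_sphereP (f : X -> RR) : dual_sphere f <->
  contractive f /\ forall t, t < 1 -> exists2 x, `|x| <= 1 & t < f x.
Proof.
split=> [[fl fs]|[[fl fb] fx]].
  have fb1 x : `|x| <= 1 -> `|f x| <= 1.
    by move=> x1; rewrite -lee_fin -fs; apply: ereal_sup_ubound; exists x.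
  split; first split => // x.
    have [->|x0] := eqVneq x 0; first by rewrite (lin_fun0 fl) !normr0.
    have nx : 0 < `|x| by rewrite normr_gt0.
    have := fb1 (`|x|^-1 *: x); rewrite normrZ normfV normr_id mulVf ?gt_eqF //.
    move=> /(_ (lexx _)); rewrite (lin_funZ fl) normrM normfV normr_id mulrC.
    by rewrite ler_pdivrMr // mul1r.
  move=> t t1; have : (t%:E < ereal_sup [set (`|f x|)%:E | x in @unit_ball X])%E.
    by rewrite fs lte_fin.
  move=> /ereal_sup_gt[_ [x x1 <-]]; rewrite lte_fin => tx.
  have [h|h] := leP 0 (f x); first by exists x => //; rewrite -(ger0_norm h).
  by exists (- x); rewrite ?normrN // (lin_funN fl) -(ltr0_norm h).
split => //; apply/eqP; rewrite eq_le; apply/andP; split.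
  by apply: ge_ereal_sup => _ [x x1 <-]; rewrite lee_fin (le_trans (fb x)).
rewrite leNgt; apply/negP => h.
have [r rE] : exists r, ereal_sup [set (`|f x|)%:E | x in @unit_ball X] = r%:E.
  have : ((`|f 0|)%:E <= ereal_sup [set (`|f x|)%:E | x in @unit_ball X])%E.
    by apply: ereal_sup_ubound; exists 0 => //; rewrite /unit_ball /= normr0.
  by move: h; case: ereal_sup => [r| |] //; exists r.
move: h; rewrite rE lte_fin => /fx[x x1 rx].
have : ((`|f x|)%:E <= r%:E)%E by rewrite -rE; apply: ereal_sup_ubound; exists x.
by rewrite lee_fin leNgt (lt_le_trans rx) // ler_norm.
Qed.

(** Passage from the dual ball, where the conditions on [V] quantify, to the dual sphere, where
    slices live. The zero functional cannot be normalized and stays a separate case. *)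
Lemma contractive_normalize F : contractive F ->
  (forall x, F x = 0) \/
  exists c, [/\ 0 < c, c <= 1, dual_sphere (fun x => c^-1 * F x) & forall x, F x <= c * `|x|].
Proof.
move=> FP; have [Fl Fb] := FP.
pose E := [set F x | x in @unit_ball X].
have E1 : ubound E 1 by move=> _ [x x1 <-]; exact: le_trans (contractive_le _ FP) _.
have E0 : E !=set0 by exists (F 0); exists 0 => //; rewrite /unit_ball /= normr0.
have hE : has_sup E by split => //; exists 1.
pose c := sup E.
have hc x : `|x| <= 1 -> F x <= c by move=> x1; apply: ub_le_sup; [exists 1|exists x].
have hcx x : F x <= c * `|x|.
  have [->|x0] := eqVneq x 0; first by rewrite (lin_fun0 Fl) normr0 mulr0.
  have nx : 0 < `|x| by rewrite normr_gt0.
  rewrite -ler_pdivrMr // mulrC -(lin_funZ Fl); apply: hc.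
  by rewrite normrZ normfV normr_id mulVf ?gt_eqF.
have : 0 <= c by rewrite -(lin_fun0 Fl); apply: hc; rewrite normr0.
rewrite le_eqVlt => /orP[/eqP c0|c0]; [left=> x|right].
  have := hcx x; have := hcx (- x); rewrite (lin_funN Fl) -c0 !mul0r; lra.
exists c; split => //; first exact: ge_sup.
apply/dual_sphereP; split.
  split; first exact: lin_fun_scale.
  move=> x; rewrite normrM normfV (gtr0_norm c0) mulrC ler_pdivrMr // mulrC.
  by rewrite ler_norml lerNl -(lin_funN Fl) -{1}(normrN x) !hcx.
move=> t t1; have tc : 0 < c - t * c by rewrite -{1}(mul1r c) -mulrBl mulr_gt0 // subr_gt0.
have [_ [x x1 <-] hx] := sup_adherent tc hE.
exists x => //; rewrite mulrC ltr_pdivlMr //.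
by move: hx; rewrite -/c; lra.
Qed.

Lemma diam2P (S : set X) : S `<=` @unit_ball X ->
  (diam S = 2%:E <-> forall e, 0 < e -> exists x y, [/\ S x, S y & 2 - e < `|x - y|]).
Proof.
move=> S1; split=> [dS e e0|h].
  have : ((2 - e)%:E < diam S)%E by rewrite dS lte_fin; lra.
  by move=> /ereal_sup_gt[_ [x Sx [y Sy <-]]]; rewrite lte_fin => hxy; exists x, y.
apply/eqP; rewrite eq_le; apply/andP; split.
  apply: ge_ereal_sup => _ [x /S1 x1 [y /S1 y1 <-]]; rewrite lee_fin.
  by move: x1 y1; rewrite /unit_ball /=; have := ler_normB x y; lra.
apply/lee_subgt0Pr => e e0; have [x [y [Sx Sy hxy]]] := h e e0.
apply: le_trans (_ : (`|x - y|)%:E <= _)%E; first by rewrite -EFinB lee_fin ltW.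
by apply: ereal_sup_ubound; exists x => //; exists y.
Qed.

Lemma norm_unit (x : X) : x != 0 -> `| `|x|^-1 *: x| = 1.
Proof. by move=> x0; rewrite normrZ normfV normr_id mulVf // normr_eq0. Qed.

Lemma dual_sphere_slice (f : X -> RR) (t : RR) :
  dual_sphere f -> t < 1 -> exists z, `|z| = 1 /\ t < f z.
Proof.
move=> /dual_sphereP[[fl fb] fx] t1.
pose s := Num.max t 0; have s1 : s < 1 by rewrite gt_max t1 ltr01.
have [x x1 sx] := fx s s1.
have s0 : 0 <= s by rewrite le_max lexx orbT.
have fx0 : 0 < f x by lra.
have x0 : x != 0 by apply/eqP => xE; move: fx0; rewrite xE (lin_fun0 fl) ltxx.
exists (`|x|^-1 *: x); split; first exact: norm_unit.
rewrite (lin_funZ fl) mulrC ltr_pdivlMr ?normr_gt0 //.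
have ts : t <= s by rewrite le_max lexx.
apply: le_lt_trans sx; apply: le_trans (_ : s * `|x| <= _); first by rewrite ler_wpM2r.
by rewrite -[leRHS]mulr1 ler_wpM2l.
Qed.

(** Almost antipodal vectors of the ball remain so after different scalings: for [b <= a],
    subtracting [(a - b) *: y] from [a *: x - b *: y] leaves [a *: (x - y)]. *)
Lemma scaled_dist (x y : X) a b d : `|x| <= 1 -> `|y| <= 1 -> 0 <= a -> 0 <= b ->
  0 <= d -> 2 - d <= `|x - y| -> a + b - d * (a + b) <= `|a *: x - b *: y|.
Proof.
wlog ab : x y a b / b <= a.
  move=> h x1 y1 a0 b0 d0 xy; have [ba|ab] := leP b a; first exact: h.
  rewrite distrC (addrC a b); apply: h => //; first exact: ltW.
  by rewrite distrC.
move=> x1 y1 a0 b0 d0 xy.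
have := ler_normB (a *: x - b *: y) ((a - b) *: y).
have -> : a *: x - b *: y - (a - b) *: y = a *: (x - y).
  by rewrite scalerBl scalerBr opprB addrA subrK.
rewrite !normrZ ger0_norm // ger0_norm ?subr_ge0 //.
have : a * (2 - d) <= a * `|x - y| by rewrite ler_wpM2l.
have : (a - b) * `|y| <= (a - b) * 1 by rewrite ler_wpM2l // subr_ge0.
have : 0 <= d * b by rewrite mulr_ge0.
by lra.
Qed.

(** The common normal form of DLD2P and DD2P ([diag = true]) and of the
    Daugavet property ([diag = false]): the slice of [B_X] or weak neighbourhood
    is given by finitely many one-sided conditions at a point [z] of the sphere. *)
Definition far_property (diag : bool) (n : nat) : Prop :=
  forall x z : X, `|x| = 1 -> `|z| = 1 -> (diag -> x = z) ->
  forall F : 'I_n -> X -> RR, (forall i, contractive (F i)) ->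
  forall e, 0 < e ->
  exists y, [/\ `|y| <= 1, 2 - e < `|x - y| & forall i, F i z - e < F i y].

(** A slice is recovered from any sphere point [z] in it, as the points where the functional does
    not drop much below its value at [z]; on the diagonal [z] is [x] itself. A zero functional
    imposes nothing, and then [- x] is at distance 2. *)
Lemma far1P (diag : bool) :
  far_property diag 1 <->
  forall e : RR, 0 < e -> forall S : set X, is_slice S ->
    forall x, (diag -> S x) -> unit_sphere x -> exists y, S y /\ 2 - e < `|x - y|.
Proof.
split=> [h e e0 S [f [a [fd [a0 ->]]]] x Sx x1|h x z x1 z1 xz F FP e e0].
  have [fc _] := (dual_sphereP f).1 fd.
  have [z [z1 az xz]] : exists z, [/\ `|z| = 1, 1 - a < f z & diag -> x = z].
    case: diag Sx {h} => [/(_ isT) [_ ax]|_]; first by exists x.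
    have [|z [z1 az]] := @dual_sphere_slice f (1 - a) fd; first by lra.
    by exists z.
  pose d := Num.min e (f z - (1 - a)).
  have d0 : 0 < d by rewrite lt_min e0; lra.
  have [y [y1 xy /(_ ord0) fy]] := h x z x1 z1 xz (fun=> f) (fun=> fc) d d0.
  have de : d <= e by rewrite ge_min lexx.
  have da : d <= f z - (1 - a) by rewrite ge_min lexx orbT.
  exists y; split; last by lra.
  by split => //; lra.
have [F0|[c [c0 c1 cd cb]]] := contractive_normalize (FP ord0).
  exists (- x); split; first by rewrite normrN x1.
    by rewrite opprK -mulr2n normrMn x1; lra.
  by move=> i; rewrite ord1 !F0; lra.
pose a := 1 - c^-1 * (F ord0 z - e).
have a0 : 0 < a.
  rewrite subr_gt0 mulrC ltr_pdivrMr // mul1r.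
  by have := cb z; rewrite z1; lra.
have [|||y [[y1 hy] xy]] := h e e0 (slice (fun x => c^-1 * F ord0 x) a) _ x.
- by exists (fun x => c^-1 * F ord0 x), a.
- move=> /xz ->; split; first by rewrite /unit_ball /= z1.
  by rewrite /a subKr ltr_pM2l ?invr_gt0 //; lra.
- by [].
exists y; split => // i; rewrite ord1.
by move: hy; rewrite /a subKr ltr_pM2l ?invr_gt0.
Qed.

Lemma DLD2P_far : DLD2P X <-> far_property true 1.
Proof.
rewrite far1P; split=> h e e0 S SS x Sx x1.
  exact: (h e e0 S SS x (Sx isT) x1).
exact: (h e e0 S SS x (fun=> Sx) x1).
Qed.

Lemma Daugavet_far : Daugavet X <-> far_property false 1.
Proof.
rewrite far1P; split=> h e e0.
  by move=> S SS x _ x1; exact: (h e e0 x x1 S SS).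
move=> x x1 S SS; have nf : false -> S x by [].
exact: (h e e0 S SS x nf x1).
Qed.

Lemma DD2P_far : DD2P X <-> forall n, far_property true n.
Proof.
split=> [h n x z x1 z1 /(_ isT) <- F FP e e0|h e e0 U [W [Wo ->]] _ x [_ Wx] x1].
  pose W := [set w | forall i, F i x - e < F i w].
  have [|||y [[y1 Wy] xy]] := h e e0 (@unit_ball X `&` W) _ _ x _ x1.
  - exists W; split => // w Ww.
    have [|d d0 hd] := @finite_pos_min n (fun i => F i w - (F i x - e)).
      by move=> i; rewrite subr_gt0; exact: Ww.
    exists n, F, d; split; first by move=> i; exact: contractive_dual_elt.
    split=> // y /= hy i; have := hy i; have := hd i.
    rewrite (lin_funB (FP i).1) ltr_norml => h1 /andP[h2 _]; lra.
  - by exists x; split; [rewrite /unit_ball /= x1|move=> i /=; lra].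
  - by split; [rewrite /unit_ball /= x1|move=> i /=; lra].
  by exists y.
have [n [g [d [gP [d0 gW]]]]] := Wo x Wx.
have /choice[M hM] : forall i, exists M : RR, 0 < M /\ contractive (fun x => M^-1 * g i x).
  by move=> i; have [M] := dual_elt_bounded (gP i); exists M.
have [|d' d'0 hd'] := @finite_pos_min n (fun i => d / M i).
  by move=> i; rewrite divr_gt0 //; case: (hM i).
pose e' := Num.min e d'; have e'0 : 0 < e' by rewrite lt_min e0.
(* A weak neighbourhood imposes two-sided bounds on [n] functionals, which become [n + n] one-sided
   ones; dividing by [M i] makes them contractive. *)
pose F (k : 'I_(n + n)) (x : X) := match fintype.split k with
  | inl i => (M i)^-1 * g i x | inr i => - ((M i)^-1 * g i x) end.
have FP k : contractive (F k).
  rewrite /F; case: (fintype.split k) => i; first by case: (hM i).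
  have [_ [l b]] := hM i.
  by split=> [a u v|u]; rewrite ?normrN // l; ring.
have [y [y1 xy Fy]] := h (n + n)%N x x x1 x1 (fun=> erefl) F FP e' e'0.
have e'e : e' <= e by rewrite ge_min lexx.
have e'd : e' <= d' by rewrite ge_min lexx orbT.
exists y; split; last by lra.
split => //; apply: gW => i /=.
have Mi : 0 < M i by case: (hM i).
have h1 := Fy (lshift n i); have h2 := Fy (rshift n i).
rewrite /F (unsplitK (inl i)) in h1; rewrite /F (unsplitK (inr i)) in h2.
have h3 := hd' i; rewrite (lin_funB (gP i).1).
have : `|(M i)^-1 * (g i y - g i x)| < d / M i.
  by rewrite mulrBr ltr_norml; apply/andP; split; lra.
by rewrite normrM gtr0_norm ?invr_gt0 // mulrC ltr_pM2r ?invr_gt0.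
Qed.

End LinearFunctionals.

(** The homogeneous form of [far_property]: [V] may contain no vector of norm one, so [y] competes
    with [z] and the target distance is the sum of the two norms. Every inequality on [y] is strict,
    for the sake of openness in [mu]. *)
Definition far_cond (mu : V -> RR) (n : nat) (x z : V) (e : RR) : Prop :=
  forall f : 'I_n -> V -> RR, (forall i, dominated mu (f i)) ->
  exists y, [/\ mu y < mu z, mu x + mu z - e < mu (x - y) &
    forall i, f i z - e < f i y].

Lemma contractive_dominated mu (X : normedModType RR) (j : V -> X) F :
  model mu j -> contractive F -> dominated mu (F \o j).
Proof.
move=> jP [Fl Fb]; split=> [q x y|x] /=; first by rewrite (mdlP jP) Fl.
by rewrite -(mdl_norm jP x) normr_id.
Qed.

Lemma far_model mu (X : normedModType RR) (j : V -> X) diag n :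
  model mu j -> (forall v, mu v = 0 -> v = 0) ->
  (far_property X diag n <->
   forall x z : V, x != 0 -> z != 0 -> (diag -> x = z) ->
   forall e, 0 < e -> far_cond mu n x z e).
Proof.
move=> jP mu0; have muP := mdl_seminorm jP.
have mugt v : v != 0 -> 0 < mu v.
  by move=> v0; rewrite lt_neqAle (sn_ge0 muP) andbT eq_sym; apply: contra_neq v0; exact: mu0.
split=> [h x z x0 z0 xz e e0 f fP|h x z x1 z1 xz F FP e e0].
  have /choice[F FE] : forall i, exists F : X -> RR,
      contractive F /\ forall v, F (j v) = f i v.
    by move=> i; have [F [? ? ?]] := dominated_ext jP (fP i); exists F.
  pose a := mu x; pose b := mu z.
  have a0 : 0 < a := mugt _ x0; have b0 : 0 < b := mugt _ z0.
  have nu (v : V) : v != 0 -> `|(mu v)^-1 *: j v| = 1.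
    move=> v0; rewrite -(mdl_norm jP) norm_unit //.
    by rewrite -normr_gt0 (mdl_norm jP); exact: mugt.
  (* Rescaling the unit vectors to norms [a] and [b] costs [d * (a + b)], half of the tolerance;
     approximation from [V] costs another quarter. *)
  pose d := e / (2 * (a + b)).
  have ab : 0 < 2 * (a + b) by lra.
  have d0 : 0 < d by rewrite divr_gt0.
  have dE : d * (a + b) = e / 2 by rewrite /d; field; rewrite gt_eqF // addr_gt0.
  have [||y [y1 xy Fy]] := h (a^-1 *: j x) (b^-1 *: j z) (nu _ x0) (nu _ z0) _ F _ d d0.
  - by move=> dg; rewrite /a /b (xz dg).
  - by move=> i; case: (FE i).
  have e2 : 0 < e / 4 by lra.
  have [|v vb vy] := @mdl_approx_ball _ _ _ jP (b *: y) b (e / 4) _ b0 e2.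
    by rewrite normrZ gtr0_norm // -[leRHS]mulr1 ler_wpM2l // ltW.
  exists v; split => //.
    have := @scaled_dist _ (a^-1 *: j x) y a b d _ y1 (ltW a0) (ltW b0) (ltW d0) (ltW xy).
    rewrite (nu _ x0) lexx => /(_ isT); rewrite scalerA mulfV ?gt_eqF // scale1r dE.
    have -> : j x - b *: y = j (x - v) - (b *: y - j v).
      by rewrite (mdlB jP) opprB addrA subrK.
    have := ler_normB (j (x - v)) (b *: y - j v); rewrite (mdl_norm jP).
    by rewrite -/a -/b; lra.
  move=> i; have [[Fl Fb] Fj] := FE i.
  have := contractive_dist (b *: y) (j v) (conj Fl Fb).
  rewrite ler_norml => /andP[_]; rewrite (lin_funZ Fl) Fj.
  have := Fy i; rewrite (lin_funZ Fl) Fj -(ltr_pM2l b0) mulrBr mulrA mulfV ?gt_eqF // mul1r.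
  have : 0 <= d * a by rewrite mulr_ge0 ?ltW.
  by move: dE; rewrite mulrDr (mulrC d b); lra.
(* The distance loses at most [5 * d]: the norms of [x'] and [z'], the tolerance of the condition,
   the approximation of [x] and the rescaling of [y] cost [d] each. The bound [1/2] keeps [x'] and
   [z'] nonzero. *)
pose d := Num.min (1/2) (e / 6).
have d0 : 0 < d by rewrite lt_min; apply/andP; split; lra.
have d2 : d <= 1/2 by rewrite ge_min lexx.
have de : d <= e / 6 by rewrite ge_min lexx orbT.
have [x' hx'] := mdl_dense jP x d0.
have [z' hz' xz'] : exists2 z', `|z - j z'| < d & diag -> x' = z'.
  case: diag xz {h} => [/(_ isT) <-|_]; first by exists x'.
  by have [z' hz'] := mdl_dense jP z d0; exists z'.
have nz (u : X) (v : V) : `|u| = 1 -> `|u - j v| < d -> 1 - d < mu v < 1 + d.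
  move=> u1 uv; have := ler_dist_dist u (j v); rewrite u1 (mdl_norm jP) ler_norml.
  by move=> /andP[h1 h2]; apply/andP; split; lra.
have /andP[x'1 x'2] := nz _ _ x1 hx'; have /andP[z'1 z'2] := nz _ _ z1 hz'.
have [|||y [y1 xy Fy]] := h x' z' _ _ xz' d d0 (fun i => F i \o j).
- by apply/eqP => x'0; move: x'1; rewrite x'0 (sn0 muP); lra.
- by apply/eqP => z'0; move: z'1; rewrite z'0 (sn0 muP); lra.
- by move=> i; exact: contractive_dominated.
(* Since [mu y < mu z' < 1 + d], this factor brings [j y] back into the unit ball and moves it by at
   most [d]. *)
pose s := (1 + d)^-1.
have s0 : 0 < s by rewrite invr_gt0; lra.
have sd : s * (1 + d) = 1 by rewrite mulVf // gt_eqF //; lra.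
have ny : `|j y| <= 1 + d by rewrite (mdl_norm jP); lra.
have yy : `|j y - s *: j y| <= d.
  rewrite -{1}(scale1r (j y)) -scalerBl normrZ.
  have -> : 1 - s = s * d by rewrite -sd; ring.
  rewrite ger0_norm; last by rewrite mulr_ge0 ?ltW.
  apply: le_trans (_ : s * d * (1 + d) <= _).
    by rewrite ler_wpM2l // mulr_ge0 ?ltW.
  by rewrite mulrAC sd mul1r.
exists (s *: j y); split.
- by rewrite normrZ gtr0_norm // -sd ler_wpM2l // ltW.
- have -> : x - s *: j y = (x - j x') + (j (x' - y) + (j y - s *: j y)).
    by rewrite (mdlB jP) !addrA !subrK.
  have := lerB_normD (j (x' - y)) (j y - s *: j y).
  have := lerB_normD (j (x' - y) + (j y - s *: j y)) (x - j x').
  rewrite (addrC _ (x - j x')) (mdl_norm jP); lra.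
move=> i; have := Fy i => /=.
have := contractive_dist (j y) (s *: j y) (FP i).
have := contractive_dist z (j z') (FP i).
by rewrite !ler_norml => /andP[h1 h2] /andP[h3 h4]; lra.
Qed.

(** * Convex combinations of slices *)

Section ConvexCombinations.
Variable X : normedModType RR.

Definition convex_comb (n : nat) (lam : 'I_n.+1 -> RR) (S : 'I_n.+1 -> set X) : set X :=
  [set z | exists x : 'I_n.+1 -> X, (forall i, S i (x i)) /\ z = \sum_(i < n.+1) lam i *: x i].

Definition ccs_property (n : nat) : Prop :=
  forall (S : 'I_n.+1 -> set X) (lam : 'I_n.+1 -> RR),
    (forall i, is_slice (S i)) -> (forall i, 0 < lam i) -> \sum_(i < n.+1) lam i = 1 ->
    diam (convex_comb lam S) = 2%:E.

Lemma SD2P_ccs : SD2P X <-> forall n, ccs_property n.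
Proof. by []. Qed.

Lemma LD2P_ccs : LD2P X <-> ccs_property 0.
Proof.
have combE (lam : 'I_1 -> RR) S : lam ord0 = 1 -> convex_comb lam S = S ord0.
  move=> l1; apply/seteqP; split=> [z [x [Sx ->]]|z Sz].
    by rewrite big_ord_recl big_ord0 addr0 l1 scale1r.
  exists (fun=> z); split=> [i|]; first by rewrite ord1.
  by rewrite big_ord_recl big_ord0 addr0 l1 scale1r.
split=> [h S lam SS _|h S SS].
  rewrite big_ord_recl big_ord0 addr0 => l1.
  by rewrite combE //; exact: h.
have := h (fun=> S) (fun=> 1) (fun=> SS) (fun=> ltr01).
by rewrite big_ord_recl big_ord0 addr0 => /(_ erefl); rewrite combE.
Qed.

(** The functional of norm one serves the case [F = 0]: any slice will do then, but one has to
    exist. *)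
Lemma slice_below (F : X -> RR) (z : X) d : (exists f : X -> RR, dual_sphere f) ->
  contractive F -> `|z| <= 1 -> 0 < d ->
  exists S, is_slice S /\ forall y, S y -> F z - d < F y.
Proof.
move=> [f0 f0d] Fc z1 d0.
have [F0|[c [c0 c1 cd cb]]] := contractive_normalize Fc.
  exists (slice f0 1); split; first by exists f0, 1.
  by move=> y _; rewrite !F0; lra.
pose a := 1 - c^-1 * (F z - d).
have a0 : 0 < a.
  rewrite subr_gt0 mulrC ltr_pdivrMr // mul1r.
  have : c * `|z| <= c * 1 by rewrite ler_pM2l.
  by have := cb z; lra.
exists (slice (fun x => c^-1 * F x) a); split; first by exists (fun x => c^-1 * F x), a.
by move=> y [y1]; rewrite /a subKr ltr_pM2l ?invr_gt0.
Qed.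

Lemma slice_unit_ball (S : set X) : is_slice S -> S `<=` @unit_ball X.
Proof. by move=> [f [a [_ [_ ->]]]] x []. Qed.

Lemma convex_comb_ball n (lam : 'I_n.+1 -> RR) S :
  (forall i, S i `<=` @unit_ball X) -> (forall i, 0 < lam i) -> \sum_i lam i = 1 ->
  convex_comb lam S `<=` @unit_ball X.
Proof.
move=> S1 l0 l1 _ [x [Sx ->]]; rewrite /unit_ball /= -l1.
apply: (le_trans (ler_norm_sum _ _ _)); apply: ler_sum => i _.
rewrite normrZ gtr0_norm // -[leRHS]mulr1 ler_pM2l //.
exact: S1 (Sx i).
Qed.

End ConvexCombinations.

(** The first alternative discards points [x i] outside the closed unit ball of [mu] by an open
    condition. One inequality on [f i (y i) + f i (z i)] replaces the two slice conditions: if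
    [f i (x i)] is close to 1, each term is close to 1 because the other is below 1. Rational
    weights only approximate real ones, so their sum is kept instead of being set to 1. *)
Definition ccs_cond (mu : V -> RR) (n : nat) (lam : 'I_n.+1 -> rat) (x : 'I_n.+1 -> V)
    (e : RR) : Prop :=
  (exists i, 1 < mu (x i)) \/
  forall f : 'I_n.+1 -> V -> RR, (forall i, dominated mu (f i)) ->
  exists y z : 'I_n.+1 -> V, [/\ forall i, mu (y i) < 1, forall i, mu (z i) < 1,
    forall i, 2 * f i (x i) - e < f i (y i) + f i (z i) &
    2 * (\sum_i ratr (lam i)) - e < mu (\sum_i lam i *: (y i - z i))].

Lemma ccs_model mu (X : normedModType RR) (j : V -> X) n :
  model mu j -> (exists f : X -> RR, dual_sphere f) ->
  (ccs_property X n <->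
   forall lam x e, (forall i, 0 < lam i) -> 0 < e -> @ccs_cond mu n lam x e).
Proof.
move=> jP f0; have muP := mdl_seminorm jP.
split=> [h lam x e lam0 e0|h S lam SS lam0 lam1].
  have [hx|hx] := pselect (exists i, 1 < mu (x i)); [by left|right=> f fP].
  have x1 i : `|j (x i)| <= 1.
    by rewrite (mdl_norm jP) leNgt; apply/negP => hi; apply: hx; exists i.
  have /choice[F FE] : forall i, exists F : X -> RR,
      contractive F /\ forall v, F (j v) = f i v.
    by move=> i; have [F [? ? ?]] := dominated_ext jP (fP i); exists F.
  pose l i : RR := ratr (lam i).
  have l0 i : 0 < l i by rewrite /l ltr0q.
  pose L := \sum_i l i.
  have L0 : 0 < L by rewrite /L big_ord_recl ltr_pwDl // sumr_ge0 // => i _; exact: ltW.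
  (* Slice and approximation errors for two vectors make [4 * d] in the functional inequality; in
     the norm inequality the diameter loses [d * L] and the approximations [2 * (d * L)]. *)
  pose d := e / (4 + 3 * L).
  have C0 : 0 < 4 + 3 * L by lra.
  have d0 : 0 < d by rewrite divr_gt0.
  have dE : 4 * d + 3 * (d * L) = e by rewrite /d; field; rewrite gt_eqF.
  have dL0 : 0 < d * L by rewrite mulr_gt0.
  have /choice[S SP] : forall i, exists S : set X,
      is_slice S /\ forall y, S y -> F i (j (x i)) - d < F i y.
    by move=> i; apply: slice_below => //; case: (FE i).
  have ls1 : \sum_i (l i / L) = 1 by rewrite -mulr_suml mulfV // gt_eqF.
  have dS : diam (convex_comb (fun i => l i / L) S) = 2%:E.
    apply: h => //; first by move=> i; case: (SP i).
    by move=> i; rewrite divr_gt0.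
  have CB : convex_comb (fun i => l i / L) S `<=` @unit_ball X.
    apply: convex_comb_ball => //; last by move=> i; rewrite divr_gt0.
    by move=> i; apply: slice_unit_ball; case: (SP i).
  have [_ [_ [[y [Sy ->]] [z [Sz ->]] hyz]]] := (diam2P CB).1 dS d d0.
  have ball i w : S i w -> `|w| <= 1.
    by move=> Sw; apply: (slice_unit_ball _ Sw); case: (SP i).
  have app i w : S i w -> exists v, mu v < 1 /\ `|w - j v| < d.
    by move=> /ball w1; have [v ? ?] := mdl_approx_ball jP w1 ltr01 d0; exists v.
  have /choice[v hv] : forall i, exists v, mu v < 1 /\ `|y i - j v| < d by move=> i; exact: app.
  have /choice[w hw] : forall i, exists v, mu v < 1 /\ `|z i - j v| < d by move=> i; exact: app.
  exists v, w; split.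
  - by move=> i; case: (hv i).
  - by move=> i; case: (hw i).
  - move=> i; have [Fc Fj] := FE i; have [_ SF] := SP i.
    have h1 := SF _ (Sy i); have h2 := SF _ (Sz i).
    have := contractive_dist (y i) (j (v i)) Fc; have := contractive_dist (z i) (j (w i)) Fc.
    rewrite !ler_norml !Fj => /andP[_ h3] /andP[_ h4].
    have [_ h5] := hv i; have [_ h6] := hw i; rewrite Fj in h1 h2.
    by move: h1 h2 h3 h4 h5 h6 dL0; lra.
  rewrite -(mdl_norm jP) (mdl_sum jP).
  have -> : \sum_i j (lam i *: (v i - w i)) = L *: (\sum_i (l i / L) *: y i - \sum_i (l i / L) *: z i)
     - \sum_i l i *: ((y i - j (v i)) - (z i - j (w i))).
    rewrite -sumrB scaler_sumr -sumrB; apply: eq_bigr => i _.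
    rewrite (mdlZ jP) (mdlB jP) -scalerBr scalerA mulrCA mulfV ?gt_eqF // mulr1 -scalerBr.
    by congr (_ *: _); rewrite [X in _ = _ - X](_ : _ = (y i - z i) - (j (v i) - j (w i))) ?subKr // !opprD !opprK addrACA.
  have h1 : L * (2 - d) < `|L *: (\sum_i (l i / L) *: y i - \sum_i (l i / L) *: z i)|.
    by rewrite normrZ gtr0_norm // ltr_pM2l.
  have h2 : `|\sum_i l i *: ((y i - j (v i)) - (z i - j (w i)))| <= 2 * (d * L).
    apply: (le_trans (ler_norm_sum _ _ _)); rewrite mulrA mulr_sumr; apply: ler_sum => i _.
    rewrite normrZ gtr0_norm // mulrC ler_pM2r //.
    apply: (le_trans (ler_normB _ _)); have [_ ?] := hv i; have [_ ?] := hw i.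
    lra.
  have := lerB_dist (L *: (\sum_i (l i / L) *: y i - \sum_i (l i / L) *: z i))
     (\sum_i l i *: ((y i - j (v i)) - (z i - j (w i)))).
  have : L * (2 - d) = 2 * L - d * L by ring.
  have -> : \sum_i ratr (lam i) = L by [].
  by move: h1 h2 dL0 dE d0; lra.
apply/diam2P.
  by apply: convex_comb_ball => // i; exact: slice_unit_ball.
move=> e e0.
have /choice[F /choice[a Fa]] : forall i, exists (F : X -> RR) a,
    [/\ dual_sphere F, 0 < a & S i = slice F a].
  by move=> i; have [F [a [? [? ?]]]] := SS i; exists F, a.
have [|a0 a00 ha0] := @finite_pos_min n.+1 a; first by move=> i; case: (Fa i).
(* With [f i] above [1 - 2 * d] at [v i] and below 1 at one vector, the other vector has value above
   [1 - 5 * d], hence lies in the slice. The diameter loses [d] by the condition and [2 * d] by the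
   change of weights. *)
pose d := Num.min (a0 / 5) (e / 3).
have d0 : 0 < d by rewrite lt_min; apply/andP; split; lra.
have da : d <= a0 / 5 by rewrite ge_min lexx.
have de : d <= e / 3 by rewrite ge_min lexx orbT.
have Fc i : contractive (F i) by have [/dual_sphereP[? _] _ _] := Fa i.
have /choice[v hv] : forall i, exists v, mu v < 1 /\ 1 - 2 * d < F i (j v).
  move=> i; have [/dual_sphereP[_ hF] _ _] := Fa i.
  have [|u u1 hu] := hF (1 - d); first by lra.
  have [v v1 uv] := mdl_approx_ball jP u1 ltr01 d0; exists v; split => //.
  have := contractive_dist u (j v) (Fc i); rewrite ler_norml => /andP[_ h1].
  by lra.
have n0 : 0 < n.+1%:R :> RR by rewrite ltr0n.
have dn0 : 0 < d / n.+1%:R by rewrite divr_gt0.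
(* Approximating from above keeps the sum of the rational weights at least 1. *)
have /choice[q hq] : forall i, exists q : rat, lam i < ratr q < lam i + d / n.+1%:R.
  by move=> i; exact: ratr_approx_gt.
have q0 i : 0 < q i.
  by rewrite -(ltr0q RR); have /andP[h1 _] := hq i; exact: lt_trans h1.
have [[i hi]|hcc] := h q v d q0 d0; first by have [h1 _] := hv i; lra.
have [|y [z [y1 z1 hyz hm]]] := hcc (fun i => F i \o j).
  by move=> i; exact: contractive_dominated.
exists (\sum_i lam i *: j (y i)), (\sum_i lam i *: j (z i)).
have SI i w : mu w < 1 -> 1 - 5 * d < F i (j w) -> S i (j w).
  move=> w1 hw; have [_ _ ->] := Fa i; split; first by rewrite /unit_ball /= (mdl_norm jP) ltW.
  by have := ha0 i; lra.
have Fle i w : mu w < 1 -> F i (j w) < 1.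
  by move=> w1; have := contractive_le (j w) (Fc i); rewrite (mdl_norm jP); lra.
split.
- exists (fun i => j (y i)); split => // i; apply: SI => //.
  by have /= := hyz i; have := Fle i _ (z1 i); have [_ ?] := hv i; lra.
- exists (fun i => j (z i)); split => // i; apply: SI => //.
  by have /= := hyz i; have := Fle i _ (y1 i); have [_ ?] := hv i; lra.
move: hm; rewrite -(mdl_norm jP) (mdl_sum jP).
have -> : \sum_i j (q i *: (y i - z i)) =
   (\sum_i lam i *: j (y i) - \sum_i lam i *: j (z i)) +
   \sum_i (ratr (q i) - lam i) *: (j (y i) - j (z i)).
  rewrite -sumrB -big_split /=; apply: eq_bigr => i _.
  by rewrite (mdlZ jP) (mdlB jP) -scalerBr -scalerDl [lam i + _]addrC subrK.
set A := \sum_i lam i *: j (y i) - \sum_i lam i *: j (z i) => hm.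
have h1 : `|\sum_i (ratr (q i) - lam i) *: (j (y i) - j (z i))| <= 2 * d.
  apply: (le_trans (ler_norm_sum _ _ _)).
  apply: (@le_trans _ _ (\sum_(i < n.+1) (d / n.+1%:R * 2))).
    apply: ler_sum => i _; have /andP[h1 h2] := hq i; rewrite normrZ.
    apply: ler_pM => //; first by rewrite ger0_norm ?subr_ge0 ?lerBlDl ltW.
    apply: (le_trans (ler_normB _ _)); rewrite !(mdl_norm jP).
    by have := y1 i; have := z1 i; lra.
  rewrite sumr_const card_ord -[leLHS]mulr_natr.
  by rewrite mulrAC mulrVK ?unitfE ?gt_eqF // mulrC.
have h2 : 1 <= \sum_i ratr (q i) :> RR.
  by rewrite -lam1; apply: ler_sum => i _; have /andP[/ltW] := hq i.
have := ler_normD A (\sum_i (ratr (q i) - lam i) *: (j (y i) - j (z i))).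
by lra.
Qed.

(** * Norming functionals and completions *)

Section Enumeration.

Lemma fin_supp_nth (s : seq rat) : fin_supp (fun n => s`_n).
Proof. by exists (size s) => n h; rewrite nth_default. Qed.

Definition V_of_seq (s : seq rat) : V := exist _ _ (fin_supp_nth s).

Lemma V_of_seq_surj v : exists s, V_of_seq s = v.
Proof.
case: v => x [N hN]; exists (mkseq x N).
apply: V_eq => n /=; have [nN|Nn] := ltnP n N; first by rewrite nth_mkseq.
by rewrite nth_default ?size_mkseq // hN.
Qed.

Definition V_enum (n : nat) : V := if unpickle n is Some s then V_of_seq s else 0.

Lemma V_enum_surj v : exists n, V_enum n = v.
Proof.
by have [s <-] := V_of_seq_surj v; exists (pickle s); rewrite /V_enum pickleK.
Qed.

End Enumeration.

(** * Norming functionals on a countable space *)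

Section HahnBanach.

Definition sublinear (p : V -> RR) : Prop :=
  (forall x y, p (x + y) <= p x + p y) /\
  (forall q x, 0 <= q -> p (q *: x) = ratr q * p x).

Lemma sublinear_0 p : sublinear p -> p 0 = 0.
Proof. by move=> [_ h]; rewrite -(scale0r 0) h // rmorph0 mul0r. Qed.

Lemma sublinear_opp p x : sublinear p -> - p (- x) <= p x.
Proof.
by move=> pP; have := pP.1 x (- x); rewrite subrr (sublinear_0 pP); lra.
Qed.

Lemma sublinear_intro p : p 0 = 0 -> (forall x y, p (x + y) <= p x + p y) ->
  (forall q x, 0 < q -> p (q *: x) <= ratr q * p x) -> sublinear p.
Proof.
move=> p0 pD pZ; split=> // q x; rewrite le_eqVlt => /orP[/eqP <-|q0].
  by rewrite scale0r p0 rmorph0 mul0r.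
apply/eqP; rewrite eq_le pZ //=.
have rq0 : 0 < ratr q :> RR by rewrite ltr0q.
have := pZ q^-1 (q *: x); rewrite invr_gt0 => /(_ q0).
rewrite scalerA mulVf ?gt_eqF // scale1r fmorphV.
by rewrite mulrC ler_pdivlMr // mulrC.
Qed.

(** The one-step reduction in the proof of Hahn-Banach by minimal sublinear functionals: the infimum
    over [t >= 0] is a sublinear functional below [p], which keeps the value at [v] and takes its
    opposite at [- v]. *)
Definition push_values (p : V -> RR) (v x : V) : set RR :=
  [set p (x + t *: v) - ratr t * p v | t in [set t : rat | 0 <= t]].
Definition push (p : V -> RR) (v x : V) : RR := inf (push_values p v x).

Section Push.
Variables (p : V -> RR) (v : V).
Hypothesis pP : sublinear p.

Lemma push_lb x : lbound (push_values p v x) (- p (- x)).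
Proof.
move=> _ [t t0 <-]; rewrite -(pP.2 _ _ t0).
by have := pP.1 (x + t *: v) (- x); rewrite addrAC subrr add0r; lra.
Qed.

Lemma push_has_inf x : has_inf (push_values p v x).
Proof.
split; last by exists (- p (- x)); exact: push_lb.
by exists (p (x + 0 *: v) - ratr 0 * p v); exists 0 => //=; rewrite lexx.
Qed.

Lemma push_leP x t : 0 <= t -> push p v x <= p (x + t *: v) - ratr t * p v.
Proof. by move=> t0; apply: ge_inf; [case: (push_has_inf x)|exists t]. Qed.

Lemma push_approx x e : 0 < e ->
  exists2 t, 0 <= t & p (x + t *: v) - ratr t * p v < push p v x + e.
Proof.
by move=> e0; have [_ [t t0 <-] h] := inf_adherent e0 (push_has_inf x); exists t.
Qed.

Lemma push_sublinear : sublinear (push p v).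
Proof.
apply: sublinear_intro.
- apply/eqP; rewrite eq_le; apply/andP; split.
    have := @push_leP 0 0 (lexx _).
    by rewrite scale0r addr0 rmorph0 mul0r subr0 (sublinear_0 pP).
  by apply: lb_le_inf; [case: (push_has_inf 0)|have := @push_lb 0; rewrite oppr0 (sublinear_0 pP) oppr0].
- move=> x y; apply/ler_addgt0Pr => e e0; have e2 : 0 < e / 2 by lra.
  have [t t0 ht] := push_approx x e2; have [s s0 hs] := push_approx y e2.
  have := @push_leP (x + y) (t + s) (addr_ge0 t0 s0).
  rewrite scalerDl addrACA ratrD mulrDl.
  have := pP.1 (x + t *: v) (y + s *: v); move: ht hs.
  by lra.
move=> q x q0; have rq0 : 0 < ratr q :> RR by rewrite ltr0q.
apply/ler_addgt0Pr => e e0; have e2 : 0 < e / ratr q by rewrite divr_gt0.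
have [t t0 ht] := push_approx x e2.
have := @push_leP (q *: x) (q * t) (mulr_ge0 (ltW q0) t0).
rewrite -scalerA -scalerDr (pP.2 _ _ (ltW q0)) ratrM -mulrA -mulrBr => /le_trans; apply.
move: ht; rewrite -(ltr_pM2l rq0) [ratr q * (_ + e / _)]mulrDr [ratr q * (e / _)]mulrCA mulfV ?gt_eqF // mulr1.
exact: ltW.
Qed.

Lemma push_le x : push p v x <= p x.
Proof. by have := @push_leP x 0 (lexx _); rewrite scale0r addr0 rmorph0 mul0r subr0. Qed.

Lemma push_opp : push p v (- v) <= - p v.
Proof.
have := @push_leP (- v) 1 ler01.
by rewrite scale1r addNr (sublinear_0 pP) rmorph1 mul1r sub0r.
Qed.
End Push.

Lemma seminorm_sublinear mu : seminorm_V mu -> sublinear mu.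
Proof.
move=> muP; split=> [x y|q x q0]; first exact: snD.
by rewrite (snZ muP) ger0_norm // ler0q.
Qed.

(** [V] being countable, a sequence of pushes replaces Zorn's lemma. The first one, along [v],
    freezes the value [mu v]; the others run through all of [V], so that the limit is odd, and an
    odd sublinear functional is linear. *)
Lemma dominated_norming mu : seminorm_V mu -> forall v,
  exists f, dominated mu f /\ f v = mu v.
Proof.
move=> muP v.
pose p := fix p n := if n is m.+1 then push (p m) (if m is k.+1 then V_enum k else v) else mu.
pose w n := if n is k.+1 then V_enum k else v.
have pS n : p n.+1 = push (p n) (w n) by [].
have pP n : sublinear (p n).
  by elim: n => [|n IH]; [exact: seminorm_sublinear|rewrite pS; exact: push_sublinear].
have p_anti x m n : (m <= n)%N -> p n x <= p m x.
  elim: n => [|n IH]; first by rewrite leqn0 => /eqP ->.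
  rewrite leq_eqVlt => /orP[/eqP -> //|/IH h].
  by apply: le_trans h; rewrite pS; exact: push_le.
have p_lb x : lbound (range (fun n => p n x)) (- mu (- x)).
  move=> _ [n _ <-]; apply: le_trans (sublinear_opp x (pP n)).
  by rewrite lerN2; exact: (p_anti (- x) 0%N n).
have p_inf x : has_inf (range (fun n => p n x)).
  by split; [exists (p 0%N x); exists 0%N|exists (- mu (- x)); exact: p_lb].
pose f x := inf (range (fun n => p n x)).
have f_le n x : f x <= p n x by apply: ge_inf; [case: (p_inf x)|exists n].
have f_app x e : 0 < e -> exists n, p n x < f x + e.
  by move=> e0; have [_ [n _ <-] h] := inf_adherent e0 (p_inf x); exists n.
have fP : sublinear f.
  apply: sublinear_intro.
  - apply/eqP; rewrite eq_le -{1}(sublinear_0 (pP 0%N)) f_le /=.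
    by apply: lb_le_inf; [case: (p_inf 0)|have := p_lb 0; rewrite oppr0 (sn0 muP) oppr0].
  - move=> x y; apply/ler_addgt0Pr => e e0; have e2 : 0 < e / 2 by lra.
    have [m hm] := f_app x _ e2; have [n hn] := f_app y _ e2.
    have h1 := p_anti x _ _ (leq_maxl m n); have h2 := p_anti y _ _ (leq_maxr m n).
    have := f_le (maxn m n) (x + y); have := (pP (maxn m n)).1 x y.
    lra.
  move=> q x q0; have rq0 : 0 < ratr q :> RR by rewrite ltr0q.
  apply/ler_addgt0Pr => e e0; have e2 : 0 < e / ratr q by rewrite divr_gt0.
  have [n hn] := f_app x _ e2; have := f_le n (q *: x).
  rewrite ((pP n).2 _ _ (ltW q0)) => /le_trans; apply.
  by move: hn; rewrite -(ltr_pM2l rq0) [ratr q * (_ + e / _)]mulrDr [ratr q * (e / _)]mulrCA mulfV ?gt_eqF // mulr1 => /ltW.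
(* The chain is [- f (w n) <= f (- w n) <= p n.+1 (- w n) <= - p n (w n) <= - f (w n)], so all its
   terms are equal. *)
have fopp_w n : f (- w n) = - f (w n) /\ f (w n) = p n (w n).
  have h1 := f_le n.+1 (- w n); rewrite pS in h1.
  have h2 := push_opp (w n) (pP n); have h3 := f_le n (w n).
  have := sublinear_opp (w n) fP; split; lra.
have fN x : f (- x) = - f x.
  by have [n <-] := V_enum_surj x; case: (fopp_w n.+1).
have fD x y : f (x + y) = f x + f y.
  apply/eqP; rewrite eq_le fP.1 /=.
  have := fP.1 (x + y) (- y); rewrite addrK fN; lra.
have fZ q x : f (q *: x) = ratr q * f x.
  have [q0|q0] := leP 0 q; first exact: fP.2.
  rewrite -[q]opprK scaleNr fN fP.2; last by rewrite oppr_ge0 ltW.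
  by rewrite [in RHS]rmorphN mulNr.
exists f; split; last by case: (fopp_w 0%N).
split=> [q x y|x]; first by rewrite fD fZ.
rewrite (ger0_norm (sn_ge0 muP _)) ler_norml lerNl -fN -{1}(snN muP x).
by rewrite (f_le 0%N (- x)) (f_le 0%N x).
Qed.
End HahnBanach.

(** * A concrete completion *)

Section Completion.
Variable mu : V -> RR.
Hypothesis muP : seminorm_V mu.

Definition dual_ball := {f : V -> RR | dominated mu f}.

(** The completion is realized as the uniform closure of the evaluations
    [v |-> (f |-> f v)] among the real functions on the dual ball. *)
Definition ev_closure (phi : dual_ball -> RR^o) : Prop :=
  forall e, 0 < e -> exists v, forall d, `|phi d - proj1_sig d v| <= e.

Definition ev_closure_pred : {pred dual_ball -> RR^o} := fun phi => `[< ev_closure phi >].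

Lemma ev_closure_bounded phi : ev_closure phi -> exists2 M, 0 < M & forall d, `|phi d| <= M.
Proof.
move=> /(_ 1 ltr01)[v hv]; have v0 := sn_ge0 muP v.
exists (1 + mu v) => [|d]; first by lra.
have aux (s t : RR) : `|s - t| <= 1 -> `|t| <= mu v -> `|s| <= 1 + mu v.
  by have := ler_normD (s - t) t; rewrite subrK; lra.
exact: aux (hv d) (dom_norm muP (proj2_sig d) v).
Qed.

Lemma ev_closure_submod : GRing.submod_closed ev_closure_pred.
Proof.
split.
  by apply/asboolP => e e0; exists 0 => -[f fP] /=; rewrite (dom0 fP) subrr normr0 ltW.
move=> a phi psi /asboolP hphi /asboolP hpsi; apply/asboolP => e e0.
have [M M0 hM] := ev_closure_bounded hphi.
pose d := Num.min 1 (e / (M + `|a| + 2)).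
have C0 : 0 < M + `|a| + 2 by have := normr_ge0 a; lra.
have d0 : 0 < d by rewrite lt_min ltr01 divr_gt0.
have d1 : d <= 1 by rewrite ge_min lexx.
have dC : d * (M + `|a| + 2) <= e by rewrite -ler_pdivlMr // ge_min lexx orbT.
have [v hv] := hphi d d0; have [w hw] := hpsi d d0; have [q hq] := ratr_approx a d0.
exists (q *: v + w) => -[f fP] /=; rewrite (domP fP).
have {}hv := hv (exist _ f fP); have {}hw := hw (exist _ f fP).
have {}hM := hM (exist _ f fP); rewrite /= in hv hw hM.
change (`|a * phi (exist _ f fP) + psi (exist _ f fP) - (ratr q * f v + f w)| <= e).
move: (phi _) (psi _) hv hw hM => s t hv hw hM.
move: (ratr q) hq => r hq.
have hr : `|r| <= `|a| + d.
  by have := ler_normB a (a - r); rewrite subKr; move: hq; lra.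
have -> : a * s + t - (r * f v + f w) = (a - r) * s + r * (s - f v) + (t - f w) by ring.
apply: le_trans dC; apply: (le_trans (ler_normD _ _)).
have h1 : `|(a - r) * s| <= d * M by rewrite normrM ler_pM // ltW.
have h2 : `|r * (s - f v)| <= (`|a| + d) * d by rewrite normrM ler_pM.
have := ler_normD ((a - r) * s) (r * (s - f v)).
have : d * d <= d * 1 by rewrite ler_pM2l.
have : d * (M + `|a| + 2) = d * M + d * `|a| + 2 * d by ring.
have : (`|a| + d) * d = d * `|a| + d * d by ring.
by lra.
Qed.

HB.instance Definition _ :=
  GRing.isSubmodClosed.Build RR (dual_ball -> RR^o) ev_closure_pred ev_closure_submod.

Definition cpl := {phi : dual_ball -> RR^o | phi \in ev_closure_pred}.
HB.instance Definition _ := SubType.on cpl.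
HB.instance Definition _ := Choice.on cpl.
HB.instance Definition _ := [SubChoice_isSubLmodule of cpl by <:].

Lemma cplP (phi : cpl) : ev_closure (\val phi).
Proof. exact/asboolP/(valP phi). Qed.

Definition cpl_norm (phi : cpl) : RR := sup (range (fun d => `|\val phi d : RR|)).

Lemma dominated0 : dominated mu (fun=> 0).
Proof. by split=> *; rewrite ?normr0 // mulr0 addr0. Qed.

Lemma cpl_norm_ub (phi : cpl) d : `|\val phi d : RR| <= cpl_norm phi.
Proof.
have [M M0 hM] := ev_closure_bounded (cplP phi).
by apply: ub_le_sup; [exists M => _ [d' _ <-]; exact: hM|exists d].
Qed.

Lemma cpl_norm_le (phi : cpl) c : (forall d, `|\val phi d : RR| <= c) -> cpl_norm phi <= c.
Proof.
move=> h; apply: ge_sup => [|_ [d _ <-]]; last exact: h.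
by exists `|\val phi (exist _ _ dominated0) : RR|; exists (exist _ _ dominated0).
Qed.

Lemma cpl_normD (x y : cpl) : cpl_norm (x + y) <= cpl_norm x + cpl_norm y.
Proof.
apply: cpl_norm_le => d; rewrite raddfD /=.
apply: (le_trans (ler_normD _ _)).
by apply: lerD; exact: cpl_norm_ub.
Qed.

Lemma cpl_normZ (a : RR) (x : cpl) : cpl_norm (a *: x) = `|a| * cpl_norm x.
Proof.
have le b y : cpl_norm (b *: y) <= `|b| * cpl_norm y.
  apply: cpl_norm_le => d; rewrite linearZ /=.
  rewrite [leLHS](_ : _ = `|b * (\val y d : RR)|) // normrM ler_wpM2l //.
  exact: cpl_norm_ub.
apply/eqP; rewrite eq_le le /=.
have [->|a0] := eqVneq a 0.
  rewrite normr0 mul0r; apply: le_trans (cpl_norm_ub _ (exist _ _ dominated0)).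
  exact: normr_ge0.
have := le a^-1 (a *: x); rewrite scalerA mulVf // scale1r normfV.
by rewrite mulrC ler_pdivlMr ?normr_gt0 // mulrC.
Qed.

Lemma cpl_norm_eq0 (x : cpl) : cpl_norm x = 0 -> x = 0.
Proof.
move=> x0; apply/val_inj/funext => d.
have := cpl_norm_ub x d; rewrite x0 normr_le0 => /eqP ->.
by [].
Qed.

HB.instance Definition _ :=
  Lmodule_isNormed.Build RR cpl cpl_normD cpl_normZ cpl_norm_eq0.

Lemma cpl_ball (x y : cpl) e : ball x e y -> forall d, `|\val x d - \val y d : RR| <= e.
Proof.
rewrite -ball_normE /= => xy d; apply: le_trans (ltW xy).
exact: le_trans (cpl_norm_ub (x - y) d).
Qed.

Lemma cpl_complete (F : set_system cpl) : ProperFilter F -> cauchy F -> cvg F.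
Proof.
move=> FF /cauchyP hF.
have /choice[u hu] : forall k : nat, exists x, F (ball x (k.+1%:R^-1 : RR)).
  by move=> k; apply: hF; rewrite invr_gt0 ltr0n.
pose r k : RR := k.+1%:R^-1.
have r0 k : 0 < r k by rewrite invr_gt0 ltr0n.
have uu d k l : `|(\val (u k) d : RR) - \val (u l) d| <= r k + r l.
  have [y [yk yl]] := filter_ex (filterI (hu k) (hu l)).
  have h1 := cpl_ball yk d; have h2 := cpl_ball yl d.
  have aux (s t w a b : RR) : `|s - w| <= a -> `|t - w| <= b -> `|s - t| <= a + b.
    by have := ler_normB (s - w) (t - w); rewrite opprB addrA subrK; lra.
  exact: aux h1 h2.
(* The pointwise limit is written as a supremum: every [u l d + r l] bounds all [u k d - r k], hence
   the supremum is within [r k] of [u k d], uniformly in [d]. *)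
pose L d := [set (\val (u k) d : RR) - r k | k in setT].
have Lub d l : ubound (L d) ((\val (u l) d : RR) + r l).
  by move=> _ [k _ <-]; have := uu d k l; rewrite ler_norml => /andP[]; lra.
pose phi (d : dual_ball) : RR^o := sup (L d).
have phiP d k : `|(\val (u k) d : RR) - phi d| <= r k.
  have h1 : phi d <= (\val (u k) d : RR) + r k.
    by apply: ge_sup; [exists ((\val (u 0%N) d : RR) - r 0%N); exists 0%N|exact: Lub].
  have h2 : (\val (u k) d : RR) - r k <= phi d.
    by apply: ub_le_sup; [exists ((\val (u 0%N) d : RR) + r 0%N); exact: Lub|exists k].
  have aux (s t a : RR) : t <= s + a -> s - a <= t -> `|s - t| <= a.
    by move=> ? ?; rewrite ler_norml; apply/andP; split; lra.
  exact: aux h1 h2.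
have rsmall e : 0 < e -> exists k, r k < e.
  exact: natinv_lt.
have phiS : phi \in ev_closure_pred.
  apply/asboolP => e e0; have e2 : 0 < e / 2 by lra.
  have [k hk] := rsmall _ e2; have [v hv] := cplP (u k) e2; exists v => d.
  have aux (s t w : RR) : `|s - w| <= r k -> `|s - t| <= e / 2 -> `|w - t| <= e.
    by have := ler_normB (s - t) (s - w); rewrite opprB addrC addrA subrK; lra.
  exact: aux (phiP d k) (hv d).
pose P : cpl := exist _ phi phiS.
apply/cvg_ex; exists P; apply/cvg_ballP => e e0.
have e2 : 0 < e / 3 by lra.
have [k hk] := rsmall _ e2; have := hu k; apply: filterS => y /cpl_ball hy.
rewrite -ball_normE /=; apply: (@le_lt_trans _ _ (r k + r k)); last by lra.
apply: cpl_norm_le => d.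
have aux (s t w : RR) : `|s - w| <= r k -> `|s - t| <= r k -> `|w - t| <= r k + r k.
  by have := ler_normB (s - t) (s - w); rewrite opprB addrC addrA subrK; lra.
exact: aux (phiP d k) (hy d).
Qed.

HB.instance Definition _ := Uniform_isComplete.Build cpl cpl_complete.

Lemma ev_in_closure v : (fun d : dual_ball => proj1_sig d v : RR^o) \in ev_closure_pred.
Proof. by apply/asboolP => e e0; exists v => d; rewrite subrr normr0 ltW. Qed.

Definition cpl_ev (v : V) : cpl :=
  exist (fun phi => phi \in ev_closure_pred) _ (ev_in_closure v).

Definition cpl_space : completeNormedModType RR := cpl.

(** Evaluation is isometric precisely because norming functionals exist; density is built into
    [ev_closure]. *)
Lemma cpl_model : model mu (cpl_ev : V -> cpl_space).
Proof.
split=> [q x y|x|x e e0].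
- by apply/val_inj/funext => -[f fP] /=; exact: (domP fP).
- apply/eqP; rewrite eq_le; apply/andP; split.
    by apply: cpl_norm_le => -[f fP]; exact: (dom_norm muP fP).
  have [f [fP fx]] := dominated_norming muP x.
  apply: le_trans (cpl_norm_ub _ (exist _ f fP)).
  by rewrite /= fx; exact: ler_norm.
have e2 : 0 < e / 2 by lra.
have [v hv] := cplP x e2; exists v.
by apply: (@le_lt_trans _ _ (e / 2)); [exact: cpl_norm_le|lra].
Qed.

End Completion.

Lemma model_exists mu : seminorm_V mu ->
  exists (X : completeNormedModType RR) (j : V -> X), model mu j.
Proof. by move=> muP; exists (cpl_space muP), (@cpl_ev mu); exact: cpl_model. Qed.

(** * Models versus completions of [c00] *)

Section CompletionModel.

Lemma sum_supp (W : nmodType) (F : nat -> W) M N :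
  (forall n, (M <= n)%N -> F n = 0) -> (forall n, (N <= n)%N -> F n = 0) ->
  \sum_(i < M) F i = \sum_(i < N) F i.
Proof.
wlog MN : M N / (M <= N)%N.
  by move=> h FM FN; have [/h|/ltnW/h] := leqP M N; [exact|move=> ->].
move=> FM _; rewrite -!(big_mkord xpredT F) [RHS](big_cat_nat _ (n := M)) //=.
rewrite [X in _ = _ + X](_ : _ = 0) ?addr0 //.
by rewrite big_nat big1 // => i /andP[Mi _]; exact: FM.
Qed.

Section Coordinates.
Variable K : nzRingType.
Local Notation S := (fsseq K).

Lemma fin_supp_delta i : fin_supp (fun n => (n == i)%:R : K).
Proof. by exists i.+1 => n h; rewrite gtn_eqF. Qed.

Definition fs_delta i : S := exist _ _ (fin_supp_delta i).

Lemma fs_sumE (I : Type) (r : seq I) (P : pred I) (F : I -> S) n :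
  proj1_sig (\sum_(i <- r | P i) F i) n = \sum_(i <- r | P i) proj1_sig (F i) n.
Proof. by elim/big_rec2: _ => // i y1 y2 _ <-. Qed.

Lemma fs_expand (x : S) N : (forall n, (N <= n)%N -> proj1_sig x n = 0) ->
  x = \sum_(i < N) proj1_sig x i *: fs_delta i.
Proof.
move=> hN; apply: fsseq_eq => n; rewrite fs_sumE /=.
have [nN|Nn] := ltnP n N.
  rewrite (bigD1 (Ordinal nN)) //= eqxx mulr1 big1 ?addr0 // => i ni.
  by rewrite (_ : _ == _ = false) ?mulr0 //; apply: contraNF ni => /eqP ni; apply/eqP/val_inj.
by rewrite hN // big1 // => i _; rewrite gtn_eqF ?mulr0 // (leq_trans (ltn_ord i)).
Qed.
End Coordinates.

Lemma fin_supp_ratr (v : V) : fin_supp (fun n => ratr (proj1_sig v n) : RR).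
Proof. by case: v => x [N hN]; exists N => n /hN /= ->; exact: rmorph0. Qed.

Definition iota_V (v : V) : c00 := exist _ _ (fin_supp_ratr v).

Lemma iota_VD x y : iota_V (x + y) = iota_V x + iota_V y.
Proof. by apply: fsseq_eq => n /=; exact: ratrD. Qed.

Lemma iota_VZ q x : iota_V (q *: x) = ratr q *: iota_V x.
Proof. by apply: fsseq_eq => n /=; exact: ratrM. Qed.

Section SeminormC00.
Variable nu : c00 -> RR.
Hypothesis nuP : seminorm_c00 nu.

Lemma nuD x y : nu (x + y) <= nu x + nu y.
Proof. exact: nuP.1. Qed.

Lemma nuZ a x : nu (a *: x) = `|a| * nu x.
Proof. exact: nuP.2. Qed.

Lemma nu0 : nu 0 = 0.
Proof. by rewrite -(scale0r 0) nuZ normr0 mul0r. Qed.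

Lemma nu_ge0 x : 0 <= nu x.
Proof.
have := nuD x (- x); rewrite subrr nu0 -scaleN1r nuZ normrN1 mul1r; lra.
Qed.

Lemma nu_sum n (F : 'I_n -> c00) : nu (\sum_i F i) <= \sum_i nu (F i).
Proof.
elim/big_rec2: _ => [|i y1 y2 _ h]; first by rewrite nu0.
by apply: (le_trans (nuD _ _)); rewrite lerD2l.
Qed.

Lemma c00_approx (x : c00) N e : (forall n, (N <= n)%N -> proj1_sig x n = 0) -> 0 < e ->
  exists v, [/\ nu (x - iota_V v) < e,
    forall n, `|proj1_sig x n - ratr (proj1_sig v n)| < e &
    forall n, (N <= n)%N -> proj1_sig v n = 0].
Proof.
move=> hN e0.
pose S := \sum_(i < N) nu (@fs_delta RR i).
have S0 : 0 <= S by apply: sumr_ge0 => i _; exact: nu_ge0.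
pose d := Num.min e (e / (S + 1)).
have d0 : 0 < d by rewrite lt_min e0 divr_gt0 //; lra.
have de : d <= e by rewrite ge_min lexx.
have dS : d * (S + 1) <= e by rewrite -ler_pdivlMr; [rewrite ge_min lexx orbT|lra].
have /choice[q hq] : forall n, exists q : rat, `|proj1_sig x n - ratr q| < d.
  by move=> n; exact: ratr_approx.
have vS : fin_supp (fun n => if (n < N)%N then q n else 0).
  by exists N => n; rewrite leqNgt => /negbTE ->.
pose v : V := exist _ _ vS; exists v; split; last 2 first.
- move=> n /=; case: ltnP => nN; first exact: lt_le_trans (hq n) de.
  by rewrite hN // rmorph0 subr0 normr0.
- by move=> n /=; rewrite leqNgt => /negbTE ->.
rewrite (@fs_expand _ (x - iota_V v) N); last first.
  by move=> n Nn /=; rewrite ltnNge Nn /= hN // rmorph0 subr0.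
apply: (le_lt_trans (nu_sum _)).
apply: (@le_lt_trans _ _ (d * S)); last by move: dS d0; rewrite mulrDr; lra.
rewrite mulr_sumr; apply: ler_sum => i _; rewrite nuZ ler_wpM2r ?nu_ge0 //=.
by rewrite ltn_ord ltW.
Qed.
End SeminormC00.

Lemma completion_model mu nu (X : completeNormedModType RR) (T : c00 -> X) :
  bar_ext mu nu -> completion_of nu T -> model mu (T \o iota_V).
Proof.
move=> [nuP numu] [TD [TZ [Tn Td]]].
have TD' x y : T (x + y) = T x + T y by exact: TD.
have TZ' a x : T (a *: x) = a *: T x by exact: TZ.
split=> [q x y|x|x e e0] /=.
- by rewrite iota_VD iota_VZ TD' TZ'.
- by rewrite Tn; exact: numu.
have e2 : 0 < e / 2 by lra.
have [|w [xT [y _ yE]]] := Td (ball x (e / 2)) _ (ball_open _ _).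
  by exists x; exact: ballxx.
have [N hN] := proj2_sig y.
have [v [hv _ _]] := c00_approx nuP hN e2; exists v.
move: xT; rewrite -yE -ball_normE /= => xT.
have := ler_normD (x - T y) (T (y - iota_V v)); rewrite Tn.
rewrite TD' -[- iota_V v]scaleN1r TZ' !scaleN1r addrA subrK.
by move: xT hv; lra.
Qed.

Section FromModel.
Variables (mu : V -> RR) (X : completeNormedModType RR) (j : V -> X).
Hypothesis jP : model mu j.

Definition model_ext (x : c00) : X :=
  \sum_(i < projT1 (cid (proj2_sig x))) proj1_sig x i *: j (@fs_delta rat i).

Lemma model_extE (x : c00) N : (forall n, (N <= n)%N -> proj1_sig x n = 0) ->
  model_ext x = \sum_(i < N) proj1_sig x i *: j (@fs_delta rat i).
Proof.
move=> hN; rewrite /model_ext; case: cid => M hM /=.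
apply: (@sum_supp _ (fun i => proj1_sig x i *: j (@fs_delta rat i))) => n h.
  by rewrite hM // scale0r.
by rewrite hN // scale0r.
Qed.

Lemma model_ext_linear a (x y z : c00) :
  (forall n, proj1_sig z n = a * proj1_sig x n + proj1_sig y n) ->
  model_ext z = a *: model_ext x + model_ext y.
Proof.
move=> zE; have [M hM] := proj2_sig x; have [N hN] := proj2_sig y.
rewrite !(@model_extE _ (maxn M N)).
- rewrite scaler_sumr -big_split /=; apply: eq_bigr => i _.
  by rewrite zE scalerDl scalerA.
- by move=> n; rewrite geq_max => /andP[_ /hN].
- by move=> n; rewrite geq_max => /andP[/hM].
by move=> n; rewrite geq_max zE => /andP[/hM -> /hN ->]; rewrite mulr0 addr0.
Qed.

Lemma model_ext_ratr (v : V) (x : c00) :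
  (forall n, proj1_sig x n = ratr (proj1_sig v n)) -> model_ext x = j v.
Proof.
move=> xE; have [N hN] := proj2_sig v.
rewrite (@model_extE _ N); last by move=> n /hN; rewrite xE => ->; exact: rmorph0.
rewrite [in RHS](@fs_expand _ v N) // (mdl_sum jP); apply: eq_bigr => i _.
by rewrite (mdlZ jP) xE.
Qed.

Lemma model_bar_ext : bar_ext mu (fun x => `|model_ext x|).
Proof.
have TD (x y z : c00) : (forall n, proj1_sig z n = proj1_sig x n + proj1_sig y n) ->
    model_ext z = model_ext x + model_ext y.
  move=> zE; rewrite (@model_ext_linear 1 x y) ?scale1r // => n.
  by rewrite mul1r.
split; last by move=> v x xE; rewrite (model_ext_ratr xE) (mdl_norm jP).
split=> [x y z /TD ->|a x z zE]; first exact: ler_normD.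
by rewrite (@model_ext_linear (a - 1) x x) ?scalerBl ?scale1r ?subrK ?normrZ // => n; rewrite zE; ring.
Qed.

Lemma model_completion : completion_of (fun x => `|model_ext x|) model_ext.
Proof.
split; last split; last split => //.
- by move=> x y z zE; rewrite (@model_ext_linear 1 x y) ?scale1r // => n; rewrite mul1r.
- by move=> a x z zE; rewrite (@model_ext_linear (a - 1) x x) ?scalerBl ?scale1r ?subrK // => n; rewrite zE; ring.
move=> O [x Ox] Oo; have /nbhs_ballP[e /= e0 he] := open_nbhs_nbhs (conj Oo Ox).
have [v hv] := mdl_dense jP x e0; exists (j v); split.
  by apply: he; rewrite -ball_normE.
by exists (iota_V v) => //; exact: model_ext_ratr.
Qed.
End FromModel.

(** [X_has] quantifies over all completions, so it yields [C] only once a completion is exhibited;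
    this is what [model_exists] is for. *)
Lemma X_hasP mu (Pr : normedModType RR -> Prop) (C : Prop) : Pset mu ->
  (forall (X : completeNormedModType RR) (j : V -> X), model mu j -> (Pr X <-> C)) ->
  X_has mu Pr <-> C.
Proof.
move=> muP h; split=> [hX|c nu munu X T XT]; last exact/(h _ _ (completion_model munu XT)).
have [X [j jP]] := model_exists muP.
by apply/(h _ _ jP); exact: hX (model_bar_ext jP) _ _ (model_completion jP).
Qed.

Lemma Bset_Pset mu : Bset mu -> Pset mu.
Proof. by case. Qed.

Lemma Bset_norm mu v : Bset mu -> mu v = 0 -> v = 0.
Proof.
move=> [muP [_ hn]] v0; have [X [j jP]] := model_exists muP.
have [nuP numu] := model_bar_ext jP.
apply: V_eq => n.
have := hn _ (conj nuP numu) (iota_V v); rewrite (numu v) // => /(_ v0 n) /= /eqP.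
by rewrite fmorph_eq0 => /eqP.
Qed.

(** A norm on [V] can degenerate on [c00], as [|a + sqrt 2 * b|] does on the first two coordinates.
    Coordinate bounds on each finite-dimensional piece prevent this, since they survive
    approximation by rational vectors with the same support bound. *)
Lemma bar_ext_norm (mu : V -> RR) nu : (forall N n, exists K, forall v,
    (forall k, (N <= k)%N -> proj1_sig v k = 0) -> `|ratr (proj1_sig v n)| <= K * mu v) ->
  bar_ext mu nu -> is_norm_c00 nu.
Proof.
move=> hK [nuP numu] x x0 n; have [N hN] := proj2_sig x; have [K KP] := hK N n.
apply/eqP; rewrite -normr_le0; apply/ler_addgt0Pr => e e0; rewrite add0r.
pose d := e / (1 + `|K|).
have C0 : 0 < 1 + `|K| by have := normr_ge0 K; lra.
have d0 : 0 < d by rewrite divr_gt0.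
have dE : d * (1 + `|K|) = e by rewrite mulfVK // gt_eqF.
have [v [h1 h2 vN]] := c00_approx nuP hN d0.
have muv : mu v <= d.
  rewrite -(numu v (iota_V v)) //.
  have := nuD nuP (x) ((-1) *: (x - iota_V v)).
  rewrite (nuZ nuP) normrN1 mul1r x0 scaleN1r opprB addrC subrK; lra.
have muv0 : 0 <= mu v by rewrite -(numu v (iota_V v)) // nu_ge0.
have h3 := KP v vN.
have h4 : K * mu v <= `|K| * d.
  apply: (@le_trans _ _ (`|K| * mu v)); first by rewrite ler_wpM2r // ler_norm.
  by rewrite ler_wpM2l.
have := ler_normD (proj1_sig x n - ratr (proj1_sig v n)) (ratr (proj1_sig v n)).
rewrite subrK; have := h2 n; move: dE; rewrite mulrDr mulr1 (mulrC d).
by lra.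
Qed.

Lemma norm_infinite_dim mu : Pset mu -> (forall nu, bar_ext mu nu -> is_norm_c00 nu) ->
  X_has mu infinite_dim.
Proof.
move=> muP hn nu munu X T [TD [TZ [Tn _]]] n v; apply: contrapT => hv.
have /choice[C hC] : forall k : 'I_n.+1, exists c : 'I_n -> RR,
    T (@fs_delta RR k) = \sum_(i < n) c i *: v i.
  move=> k; apply: contrapT => hk; apply: hv; exists (T (@fs_delta RR k)) => c hc.
  by apply: hk; exists c.
pose A : 'M[RR]_(n.+1, n) := \matrix_(k, i) C k i.
(* The images of [n.+1] unit vectors, expanded in [n] vectors, satisfy a linear relation; its
   coefficients form a nonzero vector of [c00] with [nu] equal to 0. *)
have : kermx A != 0.
  rewrite -mxrank_eq0 mxrank_ker -lt0n subn_gt0.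
  by rewrite ltnS rank_leq_col.
move=> /rowV0Pn[u /sub_kermxP uA u0].
pose x : c00 := \sum_(k < n.+1) u 0 k *: @fs_delta RR k.
have TD' y z : T (y + z) = T y + T z by exact: TD.
have TZ' a y : T (a *: y) = a *: T y by exact: TZ.
have T0 : T 0 = 0 by rewrite -(scale0r 0) TZ' scale0r.
have Tx : T x = 0.
  rewrite /x (big_morph T TD' T0).
  under eq_bigr do rewrite TZ' hC scaler_sumr.
  rewrite exchange_big /= big1 // => i _.
  under eq_bigr do rewrite scalerA.
  rewrite -scaler_suml [X in X *: _](_ : _ = 0) ?scale0r //.
  have := congr1 (fun M : 'rV_n => M 0 i) uA; rewrite !mxE => h; rewrite -[RHS]h.
  by apply: eq_bigr => k _; rewrite mxE.
have := hn _ munu x; rewrite -Tn Tx normr0 => /(_ erefl) x0.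
case/negP: u0; apply/eqP/rowP => k; rewrite mxE.
rewrite -(x0 k) fs_sumE (bigD1 k) //= eqxx mulr1 big1 ?addr0 // => i ik.
by rewrite eq_sym (_ : _ == _ = false) ?mulr0 //; apply/negbTE.
Qed.

Lemma Bset_intro mu : Pset mu ->
  (forall N n, exists K, forall v,
    (forall k, (N <= k)%N -> proj1_sig v k = 0) -> `|ratr (proj1_sig v n)| <= K * mu v) -> Bset mu.
Proof.
move=> muP hK; have hn nu : bar_ext mu nu -> is_norm_c00 nu by exact: bar_ext_norm.
by split=> //; split=> //; exact: norm_infinite_dim.
Qed.

Lemma model_dual_sphere mu (X : normedModType RR) (j : V -> X) :
  model mu j -> (forall v, mu v = 0 -> v = 0) -> exists f : X -> RR, dual_sphere f.
Proof.
move=> jP mu0; have muP := mdl_seminorm jP.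
have [f [fP fv]] := dominated_norming muP (@fs_delta rat 0).
have [F [Fl Fb Fj]] := dominated_ext jP fP.
have [F0|[c [_ _ cd _]]] := contractive_normalize (conj Fl Fb); last by eexists; exact: cd.
move: fv; rewrite -Fj F0 => /esym/mu0 /(congr1 (fun v : V => proj1_sig v 0%N)) /= /eqP.
by rewrite oner_eq0.
Qed.

End CompletionModel.

(** * The classes are G_delta *)

Local Notation RF := (RR : realType).

Section RealContinuity.
Variable T : topologicalType.
Implicit Types f g : T -> RF.

Lemma cts_cst (c : RF) : continuous (fun _ : T => c).
Proof. by move=> x; exact: cvg_cst. Qed.

Lemma cts_add f g : continuous f -> continuous g -> continuous (fun x => f x + g x).
Proof. by move=> fc gc x; apply: continuousD; [exact: fc|exact: gc]. Qed.

Lemma cts_opp f : continuous f -> continuous (fun x => - f x).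
Proof. by move=> fc x; apply: continuousN; exact: fc. Qed.

Lemma cts_mul f g : continuous f -> continuous g -> continuous (fun x => f x * g x).
Proof. by move=> fc gc x; apply: continuousM; [exact: fc|exact: gc]. Qed.

Lemma cts_norm f : continuous f -> continuous (fun x => `|f x|).
Proof. by move=> fc x; apply: cvg_norm; exact: fc. Qed.

Lemma cts_min f g : continuous f -> continuous g -> continuous (fun x => Num.min (f x) (g x)).
Proof.
move=> fc gc x; have -> : (fun x => Num.min (f x) (g x)) = (fun x => (f x + g x - `|f x - g x|) / 2).
  by apply/funext => y; case: (leP (f y) (g y)) => h; [rewrite ler0_norm|rewrite gtr0_norm]; lra.
apply: cts_mul; last exact: cts_cst.
apply: cts_add; first exact: cts_add.
by apply/cts_opp/cts_norm/cts_add => //; exact: cts_opp.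
Qed.

Lemma cts_inv f : continuous f -> (forall x, f x != 0) -> continuous (fun x => (f x)^-1).
Proof. by move=> fc f0 x; apply: cvgV => //; exact: fc. Qed.

Lemma cts_sum n (F : 'I_n -> T -> RF) : (forall i, continuous (F i)) ->
  continuous (fun x => \sum_i F i x).
Proof.
move=> Fc; elim: n F Fc => [|n IH] F Fc.
  by rewrite (_ : (fun x => _) = (fun=> 0)); [exact: cts_cst|apply/funext => x; rewrite big_ord0].
rewrite (_ : (fun x => _) = (fun x => F ord0 x + \sum_i F (lift ord0 i) x)).
  by apply: cts_add => //; exact: IH.
by apply/funext => x; rewrite big_ord_recl.
Qed.

Lemma near_gt0 f x : continuous f -> 0 < f x -> \forall y \near x, 0 < f y.
Proof.
move=> fc fx; apply: (fc x [set z | 0 < z]).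
by apply: open_nbhs_nbhs; split=> //; exact: open_gt.
Qed.

Lemma open_gt0 f : continuous f -> open [set x | 0 < f x].
Proof. by move=> /continuousP fc; exact: (fc [set z | 0 < z] (@open_gt RF 0)). Qed.
End RealContinuity.

Section DominatedOpen.
Variables (n : nat) (W : Type) (I : finType) (h : W -> I -> RV -> ('I_n -> V -> RR) -> RR).

Let T := {ptws ('I_n * V)%type -> RF}.

(** Every functional dominated by [mu] is [t mu] with [t] in a cube which does
    not depend on [mu], so that compactness of the cube gives openness in [mu]. *)
Definition scaled (p : T * RV) (i : 'I_n) (v : V) : RR := p.1 (i, v) * p.2 v.

Lemma eval1_continuous a : continuous (fun p : T * RV => p.1 a : RF).
Proof.
move=> p; apply: (@continuous_comp _ _ _ fst (fun t : T => t a : RF)).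
  exact: cvg_fst.
exact: (@proj_continuous _ (fun _ : 'I_n * V => RF) a p.1).
Qed.

Lemma eval_continuous v : continuous (fun mu : RV => mu v : RF).
Proof. by move=> mu; exact: (@proj_continuous _ (fun _ : V => RF) v mu). Qed.

Lemma eval2_continuous v : continuous (fun p : T * RV => p.2 v : RF).
Proof.
move=> p; apply: (@continuous_comp _ _ _ snd (fun mu : RV => mu v : RF)).
  exact: cvg_snd.
exact: eval_continuous.
Qed.

Lemma scaled_continuous i v : continuous (fun p : T * RV => scaled p i v : RF).
Proof. by apply: cts_mul; [exact: eval1_continuous|exact: eval2_continuous]. Qed.

Hypothesis hc : forall w i, continuous (fun p : T * RV => h w i p.2 (scaled p) : RF).

Lemma dominated_open : open [set mu : RV | forall f, (forall i, dominated mu (f i)) ->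
  exists w, forall i, 0 < h w i mu f].
Proof.
rewrite openE => mu0 /= H; pose K := [set t : T | forall a, `[(-1 : RF), 1]%classic (t a)].
have Kc : compact K.
  exact: (tychonoff (fun _ => @segment_compact RF (-1) 1)).
pose lin_defect (p : T * RV) i q x y : RF :=
  scaled p i (q *: x + y) - (ratr q * scaled p i x + scaled p i y).
have ldc i q x y : continuous (fun p => lin_defect p i q x y).
  apply: cts_add; first exact: scaled_continuous.
  apply/cts_opp/cts_add; last exact: scaled_continuous.
  by apply: cts_mul; [exact: cts_cst|exact: scaled_continuous].
(* Both alternatives persist near a point [(t, mu0)]: if [t * mu0] is not linear, some identity
   fails strictly; otherwise it is dominated by [mu0], and the witness [w] satisfies finitely many
   strict inequalities. *)
pose P (mu : RV) (t : T) := (exists i q x y, 0 < `|lin_defect (t, mu) i q x y|) \/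
  exists w, forall i, 0 < h w i mu (scaled (t, mu)).
have /compact_near_coveringP/(_ RV (nbhs mu0) P _) near_P := Kc.
have : \forall mu \near mu0, K `<=` P mu.
  apply: near_P => t Kt.
  have [[i [q [x [y xy]]]]|nlin] := pselect (exists i q x y, 0 < `|lin_defect (t, mu0) i q x y|).
    have := near_gt0 (cts_norm (ldc i q x y)) xy.
    by apply: filterS => -[t' mu'] /= h'; left; exists i, q, x, y.
  have [|w hw] := H (scaled (t, mu0)).
    move=> i; split=> [q x y|x].
      apply/eqP; rewrite -subr_eq0 -normr_eq0; apply/negPn/negP => hne; apply: nlin.
      by exists i, q, x, y; rewrite lt_neqAle eq_sym hne normr_ge0.
    have := Kt (i, x); rewrite /= in_itv /= => /andP[t1 t2].
    by rewrite normrM -[leRHS]mul1r ler_wpM2r // ler_norml t1 t2.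
  have : \forall p \near (t, mu0), forall i, 0 < h w i p.2 (scaled p).
    apply: (@filter_forall _ _ (fun i (p : T * RV) => 0 < h w i p.2 (scaled p)) (nbhs (t, mu0))).
    by move=> i; exact: (@near_gt0 _ (fun p : T * RV => h w i p.2 (scaled p) : RF) (t, mu0) (@hc w i) (hw i)).
  by apply: filterS => -[t' mu'] /= h'; right; exists w.
apply: filterS => mu hmu f fP.
(* Where [mu] vanishes the quotient is 0 by convention, and [f] vanishes there too by domination. *)
pose t : T := fun a => f a.1 a.2 / mu a.2.
have tE : scaled (t, mu) = f.
  apply/funext => i; apply/funext => v; rewrite /scaled /t /=.
  have [m0|m0] := eqVneq (mu v) 0; last by rewrite mulfVK.
  by have := (fP i).2 v; rewrite m0 normr0 normr_le0 mulr0 => /eqP.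
have [||[w hw]] := hmu t; last by exists w; rewrite tE in hw.
  move=> [i v]; rewrite /t /= in_itv /= -ler_norml normrM normfV.
  have [m0|m0] := eqVneq (mu v) 0; first by rewrite m0 normr0 invr0 mulr0 ler01.
  by rewrite ler_pdivrMr ?normr_gt0 // mul1r; exact: (fP i).2.
move=> [i [q [x [y]]]]; rewrite /lin_defect tE (fP i).1.
by rewrite subrr normr0 ltxx.
Qed.
End DominatedOpen.

Lemma far_cond_open n x z e : open [set mu : RV | far_cond mu n x z e].
Proof.
pose h (y : V) (k : option (option 'I_n)) (mu : RV) (f : 'I_n -> V -> RR) : RR :=
  match k with
  | None => mu z - mu y
  | Some None => mu (x - y) - (mu x + mu z - e)
  | Some (Some i) => f i y - (f i z - e)
  end.
rewrite (_ : [set _ | _] = [set mu : RV | forall f, (forall i, dominated mu (f i)) ->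
  exists y, forall k, 0 < h y k mu f]); last first.
  apply/seteqP; split=> mu /= H f fP; have [y] := H f fP.
    by move=> [h1 h2 h3]; exists y => -[[i|]|] /=; rewrite subr_gt0.
  move=> hy; exists y; split.
  - by have /= := hy None; rewrite subr_gt0.
  - by have /= := hy (Some None); rewrite subr_gt0.
  by move=> i; have /= := hy (Some (Some i)); rewrite subr_gt0.
apply: dominated_open => y k.
have ev v := @eval2_continuous n v; have sc i v := @scaled_continuous n i v.
have cst := @cts_cst ({ptws ('I_n * V)%type -> RF} * RV)%type.
case: k => [[i|]|] /=.
- apply: cts_add; first exact: sc.
  by apply/cts_opp/cts_add; [exact: sc|exact: cst].
- apply: cts_add; first exact: ev.
  apply/cts_opp/cts_add; last exact: cst.
  by apply: cts_add; exact: ev.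
by apply: cts_add; [exact: ev|apply: cts_opp; exact: ev].
Qed.

Lemma ccs_cond_open n lam x e : open [set mu : RV | @ccs_cond mu n lam x e].
Proof.
pose h (w : ('I_n.+1 -> V) * ('I_n.+1 -> V)) (k : option ('I_n.+1 * 'I_3)) (mu : RV)
    (f : 'I_n.+1 -> V -> RR) : RR :=
  match k with
  | None => mu (\sum_i lam i *: (w.1 i - w.2 i)) - (2 * (\sum_i ratr (lam i)) - e)
  | Some (i, c) => if c == 0 then 1 - mu (w.1 i) else if c == 1 then 1 - mu (w.2 i)
     else f i (w.1 i) + f i (w.2 i) - (2 * f i (x i) - e)
  end.
rewrite (_ : [set _ | _] = \bigcup_(i in setT) [set mu : RV | 0 < (mu (x i) - 1 : RF)] `|`
  [set mu : RV | forall f, (forall i, dominated mu (f i)) ->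
  exists w, forall k, 0 < h w k mu f]); last first.
  apply/seteqP; split=> mu /=.
    case=> [[i hi]|H]; [by left; exists i; rewrite //= subr_gt0|right=> f fP].
    have [y [z [h1 h2 h3 h4]]] := H f fP; exists (y, z) => -[[i c]|] /=; last by rewrite subr_gt0.
    by case: ifP => _; [rewrite subr_gt0|case: ifP => _; rewrite subr_gt0].
  case=> [[i _ /=]|H]; first by rewrite subr_gt0 => hi; left; exists i.
  right=> f fP; have [[y z] hyz] := H f fP; exists y, z; split.
  - by move=> i; have /= := hyz (Some (i, 0)); rewrite subr_gt0.
  - by move=> i; have /= := hyz (Some (i, 1)); rewrite subr_gt0.
  - by move=> i; have /= := hyz (Some (i, ord_max)); rewrite subr_gt0.
  by have /= := hyz None; rewrite subr_gt0.
apply: openU.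
  apply: bigcup_open => i _; apply: open_gt0.
  by apply: cts_add; [exact: eval_continuous|exact: cts_cst].
apply: dominated_open => -[y z] k.
have ev v := @eval2_continuous n.+1 v; have sc i v := @scaled_continuous n.+1 i v.
have cst := @cts_cst ({ptws ('I_n.+1 * V)%type -> RF} * RV)%type.
case: k => [[i c]|] /=.
  case: (c == 0); first by apply: cts_add; [exact: cst|apply: cts_opp; exact: ev].
  case: (c == 1); first by apply: cts_add; [exact: cst|apply: cts_opp; exact: ev].
  apply: cts_add; first by apply: cts_add; exact: sc.
  apply/cts_opp/cts_add; last exact: cst.
  by apply: cts_mul; [exact: cst|exact: sc].
by apply: cts_add; [exact: ev|exact: cst].
Qed.

Lemma far_cond_le mu n x z e e' : e' <= e -> far_cond mu n x z e' -> far_cond mu n x z e.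
Proof.
move=> ee H f fP; have [y [h1 h2 h3]] := H f fP; exists y; split=> // [|i].
  by lra.
by have := h3 i; lra.
Qed.

Lemma ccs_cond_le mu n lam x e e' : e' <= e -> @ccs_cond mu n lam x e' -> @ccs_cond mu n lam x e.
Proof.
move=> ee [|H]; [by left|right=> f fP].
have [y [z [h1 h2 h3 h4]]] := H f fP; exists y, z; split=> // [i|].
  by have := h3 i; lra.
by lra.
Qed.

Lemma class_Gdelta (Pr : normedModType RR -> Prop) (I : countType) (O : I -> set RV) :
  (forall i, open (O i)) ->
  (forall mu, Bset mu -> forall (X : completeNormedModType RR) (j : V -> X),
     model mu j -> (Pr X <-> forall i, O i mu)) ->
  exists G : set RV, Gdelta G /\ iso_class Pr = Bset `&` G.
Proof.
move=> Oo h; exists (\bigcap_i O i); split.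
  exists (fun k => if unpickle k is Some i then O i else setT).
    by move=> k; case: (unpickle k) => // ; exact: openT.
  apply/seteqP; split=> mu H.
    by move=> k _; case E: (unpickle k) => [i|] //; exact: H.
  by move=> i _; have := H (pickle i) Logic.I; rewrite pickleK.
apply/seteqP; split=> mu [muB H]; split=> //.
  by move=> i _; apply: ((X_hasP (Bset_Pset muB) (h mu muB)).1 H).
by apply/(X_hasP (Bset_Pset muB) (h mu muB)) => i; exact: H.
Qed.

(** [N] selects the admissible numbers of functionals: only 1 for DLD2P and Daugavet, every number
    for DD2P. *)
Lemma far_class_Gdelta (Pr : normedModType RR -> Prop) diag (N : nat -> bool) :
  (forall X, Pr X <-> forall n, N n -> far_property X diag n) ->
  exists G : set RV, Gdelta G /\ iso_class Pr = Bset `&` G.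
Proof.
move=> PrE.
(* Codes violating a side condition, none of which involves [mu], index the whole space, so the
   intersection may run over all codes. *)
pose O (c : nat * seq rat * seq rat * nat) := let: (n, s, r, k) := c in
  [set mu : RV | [&& N n, V_of_seq s != 0, V_of_seq r != 0 & diag ==> (V_of_seq s == V_of_seq r)] ->
     far_cond mu n (V_of_seq s) (V_of_seq r) k.+1%:R^-1].
apply: (@class_Gdelta Pr _ O) => [[[[n s] r] k]|mu muB X j jP].
  rewrite /O; case: [&& _, _, _ & _].
    rewrite (_ : [set _ | _] = [set mu : RV | far_cond mu n (V_of_seq s) (V_of_seq r) k.+1%:R^-1]).
      exact: far_cond_open.
    by apply/seteqP; split=> mu /=; [exact|move=> ? _].
  by rewrite (_ : [set _ | _] = setT); [exact: openT|apply/seteqP; split].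
rewrite PrE; split=> [H [[[n s] r] k]|H n Nn].
  move=> /and4P[Nn s0 r0 /implyP sr].
  have fc := (far_model diag n jP (fun v => Bset_norm (v := v) muB)).1 (H n Nn).
  apply: (fc _ _ s0 r0 (fun d => eqP (sr d))).
  by rewrite invr_gt0 ltr0n.
apply/(far_model diag n jP (fun v => Bset_norm (v := v) muB)) => x z x0 z0 xz e e0.
have [s sE] := V_of_seq_surj x; have [r rE] := V_of_seq_surj z.
have [k hk] := natinv_lt e0; apply: far_cond_le (ltW hk) _.
have := H (n, s, r, k); rewrite /O /= sE rE Nn x0 z0 /=; apply.
by apply/implyP => /xz ->.
Qed.

Lemma ccs_class_Gdelta (Pr : normedModType RR -> Prop) (N : nat -> bool) :
  (forall X, Pr X <-> forall n, N n -> ccs_property X n) ->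
  exists G : set RV, Gdelta G /\ iso_class Pr = Bset `&` G.
Proof.
move=> PrE.
pose lam n (l : seq rat) (i : 'I_n.+1) : rat := l`_i.
pose xs n (l : seq (seq rat)) (i : 'I_n.+1) : V := V_of_seq (nth [::] l i).
pose O (c : nat * seq rat * seq (seq rat) * nat) := let: (n, l, s, k) := c in
  [set mu : RV | N n && [forall i, 0 < lam n l i] -> ccs_cond mu (lam n l) (xs n s) k.+1%:R^-1].
apply: (@class_Gdelta Pr _ O) => [[[[n l] s] k]|mu muB X j jP].
  rewrite /O; case: (N n && _).
    rewrite (_ : [set _ | _] = [set mu : RV | ccs_cond mu (lam n l) (xs n s) k.+1%:R^-1]).
      exact: ccs_cond_open.
    by apply/seteqP; split=> mu /=; [exact|move=> ? _].
  by rewrite (_ : [set _ | _] = setT); [exact: openT|apply/seteqP; split].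
have f0 := model_dual_sphere jP (fun v => Bset_norm (v := v) muB).
rewrite PrE; split=> [H [[[n l] s] k]|H n Nn].
  move=> /andP[Nn /forallP l0].
  apply: ((ccs_model n jP f0).1 (H n Nn) _ _ _ l0).
  by rewrite invr_gt0 ltr0n.
apply/(ccs_model n jP f0) => l x e l0 e0.
have /choice[s sE] : forall i, exists s, V_of_seq s = x i by move=> i; exact: V_of_seq_surj.
have [k hk] := natinv_lt e0; apply: ccs_cond_le (ltW hk) _.
have := H (n, [seq l i | i <- enum 'I_n.+1], [seq s i | i <- enum 'I_n.+1], k).
rewrite /O /=.
have -> : lam n [seq l i | i <- enum 'I_n.+1] = l.
  by apply/funext => i; rewrite /lam (nth_map ord0) ?size_enum_ord // nth_ord_enum.
have -> : xs n [seq s i | i <- enum 'I_n.+1] = x.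
  by apply/funext => i; rewrite /xs (nth_map ord0) ?size_enum_ord // nth_ord_enum.
by apply; rewrite Nn; apply/forallP.
Qed.

(** * Step functions on the 2-adic integers *)

Lemma sum_double (W : nmodType) (F : nat -> W) N :
  \sum_(r < 2 ^ N.+1) F r = \sum_(r < 2 ^ N) F r + \sum_(r < 2 ^ N) F (r + 2 ^ N)%N.
Proof.
rewrite expnS mul2n -addnn big_split_ord /=; congr (_ + _).
by apply: eq_bigr => i _; rewrite addnC.
Qed.

Section Steps.

(** [step_val N v r] is the value of a step function on the residue class
    [r] mod [2 ^ N]; [v] lists its successive increments, the coordinate
    [2 ^ k + r] being the jump when passing from [r] mod [2 ^ k] to
    [2 ^ k + r] mod [2 ^ k.+1]. *)
Fixpoint step_val (N : nat) (v : V) (r : nat) : rat :=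
  if N is k.+1 then
    if (r < 2 ^ k)%N then step_val k v r else step_val k v (r - 2 ^ k)%N + proj1_sig v r
  else proj1_sig v 0%N.

(** Such vectors are the step functions constant on the residue classes mod [2 ^ N]. *)
Definition in_level N (v : V) := forall n, (2 ^ N <= n)%N -> proj1_sig v n = 0.

Lemma V_linE (q : rat) (x y : V) n :
  proj1_sig (q *: x + y) n = q * proj1_sig x n + proj1_sig y n.
Proof. by []. Qed.

Lemma in_levelW M N v : (M <= N)%N -> in_level M v -> in_level N v.
Proof. by move=> MN h n hn; apply: h; apply: leq_trans hn; rewrite leq_exp2l. Qed.

Lemma in_level_exists v : exists N, in_level N v.
Proof.
case: v => x [N hN]; exists N => n hn; apply: hN.
by apply: leq_trans hn; exact/ltnW/ltn_expl.
Qed.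

Lemma in_level_exists2 x y M : exists N, [/\ in_level N x, in_level N y & (M <= N)%N].
Proof.
have [N1 h1] := in_level_exists x; have [N2 h2] := in_level_exists y.
exists (maxn M (maxn N1 N2)); split; last exact: leq_maxl.
  by apply: in_levelW h1; rewrite !leq_max leqnn !orbT.
by apply: in_levelW h2; rewrite !leq_max leqnn !orbT.
Qed.

Lemma in_level_lin N (q : rat) (x y : V) : in_level N x -> in_level N y -> in_level N (q *: x + y).
Proof.
move=> hx hy n hn.
by rewrite V_linE hx // hy // mulr0 addr0.
Qed.

Lemma in_levelB N (x y : V) : in_level N x -> in_level N y -> in_level N (x - y).
Proof. by move=> hx hy; rewrite addrC -scaleN1r; exact: in_level_lin. Qed.

Lemma step_valS N v r : step_val N.+1 v r =
  if (r < 2 ^ N)%N then step_val N v r else step_val N v (r - 2 ^ N)%N + proj1_sig v r.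
Proof. by []. Qed.

Lemma step_val_lin N (q : rat) (x y : V) r :
  step_val N (q *: x + y) r = q * step_val N x r + step_val N y r.
Proof.
elim: N r => [|N IH] r; first exact: V_linE.
by rewrite !step_valS V_linE; case: ifP => _; rewrite IH //; ring.
Qed.

Lemma step_val_sub N (x y : V) r : step_val N (x - y) r = step_val N x r - step_val N y r.
Proof. by rewrite addrC -scaleN1r step_val_lin mulN1r addrC. Qed.

Lemma step_val0 N v : step_val N v 0 = proj1_sig v 0%N.
Proof. by elim: N => //= N ->; rewrite expn_gt0. Qed.

Lemma step_valS_low N v r : (r < 2 ^ N)%N -> step_val N.+1 v r = step_val N v r.
Proof. by move=> /= ->. Qed.

Lemma step_valS_high N v r :
  step_val N.+1 v (r + 2 ^ N) = step_val N v r + proj1_sig v (r + 2 ^ N)%N.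
Proof. by rewrite /= ltnNge leq_addl /= addnK. Qed.

Lemma step_val_inj N x y : in_level N x -> in_level N y ->
  (forall r, (r < 2 ^ N)%N -> step_val N x r = step_val N y r) -> x = y.
Proof.
move=> hx hy h; apply: V_eq => n.
have [nN|] := ltnP n (2 ^ N); last by move=> Nn; rewrite hx // hy.
suff : forall k, (k < 2 ^ N)%N -> proj1_sig x k = proj1_sig y k by exact.
elim: N h {nN hx hy} => [|N IH] h k hk.
  by have := h 0%N isT; move: hk; rewrite expn0 ltnS leqn0 => /eqP ->; rewrite !step_val0.
have {}IH : forall k, (k < 2 ^ N)%N -> proj1_sig x k = proj1_sig y k.
  apply: IH => r hr; rewrite -(step_valS_low x hr) -(step_valS_low y hr); apply: h.
  by apply: (leq_trans hr); rewrite leq_exp2l.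
have [kN|Nk] := ltnP k (2 ^ N); first exact: IH.
have hkN : (k - 2 ^ N < 2 ^ N)%N by rewrite ltn_subLR // addnn -mul2n -expnS.
have := h k hk; rewrite -(subnK Nk) !step_valS_high.
have := h (k - 2 ^ N)%N; rewrite !step_valS_low // => -> //; last first.
  by apply: (leq_trans hkN); rewrite leq_exp2l.
by move=> /addrI.
Qed.

(** The sequence lists the increments of the step function with values [g]: deleting the leading
    binary digit of [n] gives the residue from which the class of [n] branches off. *)
Lemma step_fin_supp N (g : nat -> rat) : fin_supp (fun n =>
  if (n < 2 ^ N)%N then (if n == 0%N then g 0%N else g n - g (n - 2 ^ trunc_log 2 n)%N) else 0).
Proof. by exists (2 ^ N)%N => n; rewrite leqNgt => /negbTE ->. Qed.

Definition step_of N (g : nat -> rat) : V := exist _ _ (step_fin_supp N g).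

Lemma step_of_level N g : in_level N (step_of N g).
Proof. by move=> n; rewrite leqNgt /= => /negbTE ->. Qed.

Lemma step_ofK N g r : (r < 2 ^ N)%N -> step_val N (step_of N g) r = g r.
Proof.
have gen k : (k <= N)%N -> forall r, (r < 2 ^ k)%N -> step_val k (step_of N g) r = g r.
  elim: k => [|k IH] kN s.
    by rewrite expn0 ltnS leqn0 => /eqP -> /=; rewrite expn_gt0.
  move=> hs; have [sk|ks] := ltnP s (2 ^ k).
    by rewrite step_valS_low // IH // ltnW.
  have hsk : (s - 2 ^ k < 2 ^ k)%N by rewrite ltn_subLR // addnn -mul2n -expnS.
  rewrite -{1}(subnK ks) step_valS_high (IH (ltnW kN)) // subnK //=.
  rewrite (leq_trans hs) ?leq_exp2l //.
  have s0 : (s == 0%N) = false by rewrite gtn_eqF // (leq_trans _ ks) // expn_gt0.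
  rewrite s0 (@trunc_log_eq 2 k s) ?ks ?hs // addrC subrK //.
by move=> hr; apply: gen.
Qed.

Lemma step_expand N v : in_level N v ->
  v = \sum_(t < 2 ^ N) step_val N v t *: step_of N (fun r => (r == t)%:R).
Proof.
move=> hv; have gen (s : seq 'I_(2 ^ N)) :
   in_level N (\sum_(t <- s) step_val N v t *: step_of N (fun r => (r == t)%:R)) /\
   forall r, (r < 2 ^ N)%N ->
   step_val N (\sum_(t <- s) step_val N v t *: step_of N (fun r => (r == t)%:R)) r =
   \sum_(t <- s) step_val N v t * (r == t)%:R.
  elim: s => [|t s [IH1 IH2]]; split.
  - by rewrite big_nil.
  - move=> r hr; rewrite !big_nil; have := step_val_lin N 0 0 0 r.
    by rewrite scale0r addr0 mul0r add0r => <-; have := step_val_sub N 0 0 r; rewrite !subrr.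
  - by rewrite big_cons; apply: in_level_lin => //; exact: step_of_level.
  by move=> r hr; rewrite !big_cons step_val_lin step_ofK // IH2.
have [h1 h2] := gen (index_enum 'I_(2 ^ N)).
apply: (@step_val_inj N) => // r hr; rewrite h2 // (bigD1 (Ordinal hr)) //= eqxx mulr1 big1 ?addr0 //.
move=> i ir; rewrite (_ : (r == i) = false) ?mulr0 //.
by apply: contraNF ir => /eqP ri; apply/eqP/val_inj.
Qed.

(** A value is a sum of distinct coordinates of [v]. The bound has to be uniform in the level,
    because the level is later refined until all masses are small compared with it. *)
Lemma step_val_bounded v : exists2 M, 0 <= M & forall N r, (r < 2 ^ N)%N ->
  `|ratr (step_val N v r) : RR| <= M.
Proof.
pose a n : RR := `|ratr (proj1_sig v n)|.
have h N r : (r < 2 ^ N)%N -> `|ratr (step_val N v r) : RR| <= \sum_(k < 2 ^ N) a k.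
  elim: N r => [|N IH] r; first by rewrite expn0 big_ord_recl big_ord0 addr0 ltnS leqn0 => /eqP ->.
  rewrite sum_double => hr; have [rN|Nr] := ltnP r (2 ^ N).
    rewrite step_valS_low //; apply: (le_trans (IH _ rN)).
    by rewrite lerDl; apply: sumr_ge0 => i _; exact: normr_ge0.
  have hrN : (r - 2 ^ N < 2 ^ N)%N by rewrite ltn_subLR // addnn -mul2n -expnS.
  rewrite -(subnK Nr) step_valS_high ratrD.
  apply: (le_trans (ler_normD _ _)); apply: lerD; first exact: IH.
  rewrite (bigD1 (Ordinal hrN)) //= lerDl; apply: sumr_ge0 => i _; exact: normr_ge0.
have [L hL] := in_level_exists v.
exists (\sum_(k < 2 ^ L) a k); first by apply: sumr_ge0 => i _; exact: normr_ge0.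
move=> N r hr; apply: (le_trans (h _ _ hr)).
have [LN|NL] := leqP L N.
  rewrite (@sum_supp _ a (2 ^ N) (2 ^ L)) // => n hn; rewrite /a.
    by rewrite (in_levelW LN hL) // rmorph0 normr0.
  by rewrite hL // rmorph0 normr0.
rewrite -!(big_mkord xpredT a) [leRHS](big_cat_nat _ (n := 2 ^ N)) //=.
  by rewrite lerDl; apply: sumr_ge0 => i _; exact: normr_ge0.
by rewrite leq_exp2l // ltnW.
Qed.
End Steps.

Section StepNorm.
Variable m : nat -> nat -> RR.
Hypothesis m_gt0 : forall N r, (r < 2 ^ N)%N -> 0 < m N r.
Hypothesis m_add : forall N r, (r < 2 ^ N)%N -> m N r = m N.+1 r + m N.+1 (r + 2 ^ N)%N.

Local Notation P N v r := (ratr (step_val N v r) : RR).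

Definition level_norm N (v : V) : RR := \sum_(r < 2 ^ N) m N r * `|P N v r|.
Definition step_norm (v : V) : RR := level_norm (projT1 (cid (in_level_exists v))) v.

Lemma level_normS N v : in_level N v -> level_norm N.+1 v = level_norm N v.
Proof.
move=> hv; rewrite /level_norm (sum_double (fun r => m N.+1 r * `|P N.+1 v r|)) -big_split /=.
apply: eq_bigr => -[r hr] _ /=; rewrite hr ltnNge leq_addl /= addnK.
by rewrite (hv (r + 2 ^ N)%N) ?leq_addl // addr0 -mulrDl -m_add.
Qed.

Lemma level_norm_ge M N v : (M <= N)%N -> in_level M v -> level_norm N v = level_norm M v.
Proof.
move=> /subnK <- hv; elim: (N - M)%N => //= k IH.
by rewrite addSn level_normS //; apply: in_levelW hv; exact: leq_addl.
Qed.

Lemma step_normE N v : in_level N v -> step_norm v = level_norm N v.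
Proof.
move=> hN; rewrite /step_norm; case: cid => M hM /=.
have [MN|/ltnW NM] := leqP M N; first by rewrite (level_norm_ge MN).
by rewrite (level_norm_ge NM).
Qed.

Lemma step_norm_seminorm : seminorm_V step_norm.
Proof.
split=> [x y z zE|q x z zE].
  have -> : z = x + y by apply: V_eq => n; rewrite zE.
  have [N [hx hy _]] := in_level_exists2 x y 0.
  have hxy : in_level N (x + y) by rewrite -(scale1r x); exact: in_level_lin.
  rewrite !(@step_normE N) // /level_norm -big_split; apply: ler_sum => -[r hr] _ /=.
  rewrite -mulrDr ler_pM2l ?m_gt0 // -{1}(scale1r x) step_val_lin mul1r ratrD.
  exact: ler_normD.
have -> : z = q *: x by apply: V_eq => n; rewrite zE.
have [N hx] := in_level_exists x.
have hz : in_level N (q *: x) by move=> n /hx /= ->; rewrite mulr0.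
rewrite !(@step_normE N) // /level_norm mulr_sumr; apply: eq_bigr => -[r hr] _ /=.
have -> : step_val N (q *: x) r = q * step_val N x r.
  rewrite -[q *: x]addr0 step_val_lin; have := step_val_sub N 0 0 r.
  by rewrite !subrr => ->; rewrite addr0.
by rewrite ratrM normrM mulrCA.
Qed.

Lemma step_norm_val N v r : in_level N v -> (r < 2 ^ N)%N -> m N r * `|P N v r| <= step_norm v.
Proof.
move=> hv hr; rewrite (step_normE hv) /level_norm (bigD1 (Ordinal hr)) //= lerDl.
by apply: sumr_ge0 => -[i hi] _; rewrite mulr_ge0 // ltW // m_gt0.
Qed.


(** A coordinate is the difference of two values of the step function, at [n] and at [n] without its
    leading binary digit. A value is at most the norm divided by the mass of its class, which is
    positive. *)
Lemma step_norm_coord N n : exists K, forall v,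
  (forall k, (N <= k)%N -> proj1_sig v k = 0) -> `|ratr (proj1_sig v n) : RR| <= K * step_norm v.
Proof.
have val L r : (r < 2 ^ L)%N -> forall v, in_level L v -> `|P L v r| <= (m L r)^-1 * step_norm v.
  by move=> hr v hv; rewrite mulrC ler_pdivlMr ?m_gt0 // mulrC; exact: step_norm_val.
pose L := maxn N n; have lev v : (forall k, (N <= k)%N -> proj1_sig v k = 0) -> in_level L.+1 v.
  move=> hv k hk; apply: hv; apply: leq_trans hk; apply: leq_trans (ltnW (ltn_expl L.+1 _)) => //.
  exact: leq_trans (leq_maxl N n) _.
have nL : (n < 2 ^ L)%N by apply: leq_trans (ltn_expl _ _) => //; rewrite ltnS leq_maxr.
have [->|n0] := posnP n.
  exists (m L.+1 0)^-1 => v /lev hv; rewrite -(step_val0 L.+1 v).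
  by apply: val => //; rewrite expn_gt0.
pose k := trunc_log 2 n; have /andP[kn nk] : (2 ^ k <= n < 2 ^ k.+1)%N by exact: trunc_log_bounds.
have low M v r : (k <= M)%N -> (r < 2 ^ k)%N -> step_val M v r = step_val k v r.
  move=> /subnK <- hr; elim: (M - k)%N => //= i IH.
  by rewrite (leq_trans hr) // leq_exp2l // leq_addl.
have low1 M v r : (k.+1 <= M)%N -> (r < 2 ^ k.+1)%N -> step_val M v r = step_val k.+1 v r.
  move=> /subnK <- hr; elim: (M - k.+1)%N => //= i IH.
  by rewrite (leq_trans hr) ?IH // leq_exp2l // leq_addl.
have kL : (k <= L)%N.
  by rewrite -(leq_exp2l k L (ltnSn 1)) (leq_trans kn) // ltnW.
have hs : (n - 2 ^ k < 2 ^ k)%N by rewrite ltn_subLR // addnn -mul2n -expnS.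
have hs' : (n - 2 ^ k < 2 ^ L.+1)%N by apply: leq_trans hs _; rewrite leq_exp2l // leqW.
have hn' : (n < 2 ^ L.+1)%N by apply: leq_trans nL _; rewrite leq_exp2l.
exists ((m L.+1 n)^-1 + (m L.+1 (n - 2 ^ k))^-1) => v /lev hv.
have -> : proj1_sig v n = step_val L.+1 v n - step_val L.+1 v (n - 2 ^ k).
  rewrite (low _ _ _ (leqW kL) hs) (low1 _ _ _ _ nk) ?ltnS //.
  by rewrite -{2}(subnK kn) step_valS_high subnK // addrC addKr.
rewrite raddfB mulrDl; apply: (le_trans (ler_normB _ _)).
by apply: lerD; exact: val.
Qed.

Lemma step_norm_Bset : Bset step_norm.
Proof. by apply: Bset_intro; [exact: step_norm_seminorm|exact: step_norm_coord]. Qed.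
End StepNorm.

(** * Concentration for small masses *)

Section Representatives.

(** Vectors of the cube [[-1, 1] ^ n] are grouped by cells of small diameter,
    and each nonempty cell elects a representative. *)
Lemma representatives (n : nat) (e : RR) : 0 < e -> exists C : nat,
  forall (J : finType) (x : 'I_n -> J -> RR), (forall i t, `|x i t| <= 1) ->
  exists rho : J -> J, (forall i t, `|x i (rho t) - x i t| <= e) /\ (#|codom rho| <= C)%N.
Proof.
move=> e0; have [K hK] := natinv_lt e0; pose k : RR := K.+1%:R.
have k0 : 0 < k by rewrite ltr0n.
exists #|{ffun 'I_n -> 'I_(K.+1 * 2).+1}| => J x x1.
(* [(x + 1) * k] ranges over [[0, 2 k]] with the right end included, hence one cell more than
   [2 k]. *)
pose cell t : {ffun 'I_n -> 'I_(K.+1 * 2).+1} := [ffun i => inord (Num.truncn ((x i t + 1) * k))].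
have xk i t : 0 <= (x i t + 1) * k <= (K.+1 * 2)%:R.
  have := x1 i t; rewrite ler_norml => /andP[h1 h2].
  rewrite mulr_ge0 /=; [|lra|exact: ltW].
  by rewrite natrM mulrC ler_pM2l //; lra.
have cellE i t : (cell t i)%:R <= (x i t + 1) * k < (cell t i)%:R + 1.
  have /andP[h1 h2] := xk i t; rewrite ffunE inordK.
    by have := truncn_itv h1; rewrite -natr1.
  rewrite ltnS -(ler_nat RR); apply: le_trans h2.
  by have /andP[] := truncn_itv h1.
pose rho t := odflt t [pick s | cell s == cell t].
have rhoE t : cell (rho t) = cell t.
  by rewrite /rho; case: pickP => [s /eqP //|/(_ t)]; rewrite eqxx.
exists rho; split.
  move=> i t; have := cellE i t; have := cellE i (rho t); rewrite rhoE => /andP[h1 h2] /andP[h3 h4].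
  rewrite -(ler_pM2r k0) -{1}(ger0_norm (ltW k0)) -normrM.
  have h5 : 1 <= e * k by rewrite -ler_pdivrMr // div1r ltW.
  by rewrite mulrBl ler_norml; apply/andP; split; lra.
have rhorho t t' : cell t = cell t' -> rho t = rho t'.
  move=> tt; rewrite /rho tt; case: pickP => [//|/(_ t')]; by rewrite eqxx.
apply: (@leq_card_in _ _ cell) => a b /codomP[t ->] /codomP[t' ->].
by rewrite !rhoE; exact: rhorho.
Qed.
End Representatives.

Section Concentrate.
Variables (J : finType) (w z u : J -> RR) (n : nat) (c : 'I_n -> J -> RR).
Hypothesis w0 : forall t, 0 < w t.
Hypothesis cw : forall i t, `|c i t| <= w t.

Let sg t : RR := if 0 <= z t then 1 else -1.
Let sg1 t : `|sg t| = 1.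
Proof. by rewrite /sg; case: ifP; rewrite ?normrN normr1. Qed.
Let zE t : z t = sg t * `|z t|.
Proof.
rewrite /sg; case: leP => h; first by rewrite ger0_norm // mul1r.
by rewrite ltr0_norm // mulN1r opprK.
Qed.

(** The mass [w t * |z t|] of each fibre of [rho] is moved to its representative, with the sign [z]
    has there. Signed densities [sg * c / w] are almost constant on fibres, so the pairings hardly
    change. The new vector lives on [codom rho]; off this set [u] is untouched, so the norms add up
    to twice the part of [u] on it. *)
Lemma concentrate e : 0 < e -> forall rho : J -> J,
  (forall i t, `|sg (rho t) * c i (rho t) / w (rho t) - sg t * c i t / w t| <= e) ->
  exists b : J -> RR, [/\ \sum_t w t * `|b t| = \sum_t w t * `|z t|,
    forall i, `|\sum_t b t * c i t - \sum_t z t * c i t| <= e * \sum_t w t * `|z t| &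
    \sum_t w t * `|u t| + \sum_t w t * `|z t| - 2 * \sum_(t in codom rho) w t * `|u t|
      <= \sum_t w t * `|u t - b t|].
Proof.
move=> e0 rho rhoP.
pose G s := \sum_(t | rho t == s) w t * `|z t|.
have G0 s : 0 <= G s by apply: sumr_ge0 => t _; rewrite mulr_ge0 // ltW.
pose b s := sg s * G s / w s.
have wb s : w s * `|b s| = G s.
  rewrite /b !normrM sg1 mul1r (ger0_norm (G0 s)) normfV (gtr0_norm (w0 s)).
  by rewrite mulrC mulfVK // gt_eqF.
have sumG (F : J -> RR) : \sum_s F s * G s = \sum_t F (rho t) * (w t * `|z t|).
  rewrite [RHS](partition_big rho xpredT) //=; apply: eq_bigr => s _.
  by rewrite mulr_sumr; apply: eq_bigr => t /eqP ->.
have normb : \sum_t w t * `|b t| = \sum_t w t * `|z t|.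
  transitivity (\sum_s 1 * G s); first by apply: eq_bigr => s _; rewrite wb mul1r.
  by rewrite (sumG (fun=> 1)); apply: eq_bigr => t _; rewrite mul1r.
exists b; split => //.
- move=> i; have -> : \sum_t b t * c i t = \sum_s (sg s * c i s / w s) * G s.
    by apply: eq_bigr => s _; rewrite /b; ring.
  rewrite sumG -sumrB mulr_sumr; apply: (le_trans (ler_norm_sum _ _ _)).
  apply: ler_sum => t _.
  have -> : z t * c i t = sg t * c i t / w t * (w t * `|z t|).
    by rewrite {1}zE; field; rewrite gt_eqF.
  have wz0 : 0 <= w t * `|z t| by rewrite mulr_ge0 // ltW.
  by rewrite -mulrBl normrM (ger0_norm wz0) ler_wpM2r.
rewrite -normb -big_split /= [X in _ - 2 * X]big_mkcond /= mulr_sumr -sumrB.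
apply: ler_sum => t _; case: ifP => tr; last first.
  have -> : b t = 0.
    rewrite /b (_ : G t = 0) ?mulr0 ?mul0r // /G big1 // => s /eqP st.
    by move: tr; rewrite -st codom_f.
  by rewrite normr0 !mulr0 subr0 addr0 subr0.
have := ler_wpM2l (ltW (w0 t)) (lerB_dist (b t) (u t)).
by rewrite distrC mulrBr; lra.
Qed.
End Concentrate.

Section SmallMasses.
Variable m : nat -> nat -> RR.
Hypothesis m_gt0 : forall N r, (r < 2 ^ N)%N -> 0 < m N r.
Hypothesis m_add : forall N r, (r < 2 ^ N)%N -> m N r = m N.+1 r + m N.+1 (r + 2 ^ N)%N.
Hypothesis m_small : forall e, 0 < e -> exists N, forall r, (r < 2 ^ N)%N -> m N r < e.

Local Notation P N v r := (ratr (step_val N v r) : RR).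
Local Notation mu := (step_norm m).
Local Notation chi N t := (step_of N (fun r => (r == t)%:R)).

Lemma total_mass N : \sum_(r < 2 ^ N) m N r = m 0 0.
Proof.
elim: N => [|N <-]; first by rewrite expn0 big_ord_recl big_ord0 addr0.
rewrite (sum_double (fun r => m N.+1 r)) -big_split /=; apply: eq_bigr => -[r hr] _ /=.
by rewrite -m_add.
Qed.

Lemma small_masses e : 0 < e -> exists N, forall N', (N <= N')%N ->
  forall r, (r < 2 ^ N')%N -> m N' r < e.
Proof.
move=> e0; have [N hN] := m_small e0; exists N => N' /subnK <-.
elim: (N' - N)%N => //= k IH r; rewrite addSn => hr.
have [rk|kr] := ltnP r (2 ^ (k + N)).
  apply: le_lt_trans (IH _ rk); rewrite (m_add rk) lerDl ltW // m_gt0 //.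
  by rewrite expnS mul2n -addnn ltn_add2r.
have hr' : (r - 2 ^ (k + N) < 2 ^ (k + N))%N by rewrite ltn_subLR // addnn -mul2n -expnS.
apply: le_lt_trans (IH _ hr'); rewrite (m_add hr') subnK // lerDr ltW // m_gt0 //.
by apply: (leq_trans hr'); rewrite leq_exp2l.
Qed.

Lemma chi_norm N t : (t < 2 ^ N)%N -> mu (chi N t) = m N t.
Proof.
move=> ht; rewrite (step_normE m_add (@step_of_level N _)) /level_norm.
rewrite (bigD1 (Ordinal ht)) //= step_ofK // eqxx rmorph1 normr1 mulr1 big1 ?addr0 //.
move=> -[r hr] /= rt; rewrite step_ofK //.
rewrite (_ : (r == t) = false) ?rmorph0 ?normr0 ?mulr0 //.
by apply: contraNF rt => /eqP rt; apply/eqP/val_inj.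
Qed.

Lemma dominated_level f N v : dominated mu f -> in_level N v ->
  f v = \sum_(t < 2 ^ N) P N v t * f (chi N t).
Proof.
move=> fP hv; rewrite {1}(step_expand hv) (dom_sum fP).
by apply: eq_bigr => t _; rewrite (domZ fP).
Qed.

Lemma level_approx N (b : 'I_(2 ^ N) -> RR) d : 0 < d ->
  exists y, in_level N y /\ forall t : 'I_(2 ^ N), `|P N y t - b t| <= d.
Proof.
move=> d0; have /choice[q hq] : forall t, exists q : rat, `|b t - ratr q| < d.
  by move=> t; exact: ratr_approx.
exists (step_of N (fun r => if insub r is Some t then q t else 0)); split.
  exact: step_of_level.
by move=> t; rewrite step_ofK // valK distrC ltW.
Qed.

(** The order of the choices is decisive: the number [C] of representatives depends on [n] and the
    tolerance but not on the level. The level can thus be taken afterwards so fine that [C] classes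
    carry almost nothing of [u]. *)
Lemma step_norm_concentrate (u z : V) n (f : 'I_n -> V -> RR) e :
  z != 0 -> (forall i, dominated mu (f i)) -> 0 < e ->
  exists y, [/\ mu y < mu z, mu u + mu z - e < mu (u - y) & forall i, `|f i y - f i z| < e].
Proof.
move=> z0 fP e0; have muP := step_norm_seminorm m_gt0 m_add.
pose B := mu z; have B0 : 0 < B.
  rewrite lt_neqAle (sn_ge0 muP) andbT eq_sym; apply: contra_neq z0.
  exact: (Bset_norm (step_norm_Bset m_gt0 m_add)).
have [M M0 hM] := step_val_bounded u.
pose e1 := e / (4 * B); have e10 : 0 < e1 by rewrite divr_gt0 // mulr_gt0.
have e1B : e1 * B = e / 4 by rewrite /e1; field; rewrite gt_eqF.
have [C hC] := representatives n e10.
(* [C] classes of mass below [ka], on which [u] is bounded by [M], carry at most [e / 8] of its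
   norm; the summand 1 keeps the denominator positive. *)
pose ka := e / (8 * (C%:R * M + 1)).
have CM : 0 < C%:R * M + 1 by rewrite ltr_wpDl // mulr_ge0.
have ka0 : 0 < ka by rewrite divr_gt0 // mulr_gt0.
have kaE : C%:R * M * ka <= e / 8.
  have -> : e / 8 = (C%:R * M + 1) * ka by rewrite /ka; field; rewrite gt_eqF.
  by rewrite ler_pM2r //; lra.
have [N0 hN0] := small_masses ka0.
have [N [hu hz N0N]] := in_level_exists2 u z N0.
pose w (t : 'I_(2 ^ N)) := m N t; have w0 t : 0 < w t by apply: m_gt0.
have wka (t : 'I_(2 ^ N)) : w t < ka by apply: hN0.
pose zz (t : 'I_(2 ^ N)) := P N z t; pose uu (t : 'I_(2 ^ N)) := P N u t.
pose c i (t : 'I_(2 ^ N)) := f i (chi N t).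
have cw i t : `|c i t| <= w t.
  by rewrite /w -chi_norm //; exact: (dom_norm muP (fP i)).
have normE v : in_level N v -> mu v = \sum_(t < 2 ^ N) w t * `|P N v t|.
  by move=> hv; exact: (step_normE m_add hv).
pose sg t : RR := if 0 <= zz t then 1 else -1.
have [|rho [rhoP rhoC]] := hC _ (fun i t => sg t * c i t / w t).
  move=> i t; rewrite normrM normfV (gtr0_norm (w0 t)) ler_pdivrMr // mul1r.
  rewrite normrM (_ : `|sg t| = 1) ?mul1r //.
  by rewrite /sg; case: ifP; rewrite ?normrN normr1.
have [b [b1 b2 b3]] := concentrate uu w0 e10 rhoP.
have hB : \sum_t w t * `|zz t| = B by rewrite -normE.
have hU : \sum_t w t * `|uu t| = mu u by rewrite -normE.
have hS : \sum_(t in codom rho) w t * `|uu t| <= e / 8.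
  apply: le_trans kaE; apply: (@le_trans _ _ (\sum_(t in codom rho) ka * M)).
    by apply: ler_sum => t _; apply: ler_pM => //; [exact: ltW|exact: ltW|exact: hM].
  rewrite sumr_const -[leLHS]mulr_natl -mulrA (mulrC M); apply: ler_wpM2r.
    by rewrite mulr_ge0 // ltW.
  by rewrite ler_nat.
rewrite hB in b1 b2 b3; rewrite hU in b3.
(* [b] has norm exactly [B] and real values. Shrinking by [1 - eta] makes room both for rational
   values and for the strict inequality [mu y < mu z]. *)
pose eta := Num.min (1/2) (e / (8 * B)).
have eta0 : 0 < eta by rewrite lt_min; apply/andP; split; [lra|rewrite divr_gt0 // mulr_gt0].
have etah : eta <= 1/2 by rewrite ge_min lexx.
have etaB : eta * B <= e / 8.
  have : eta <= e / (8 * B) by rewrite ge_min lexx orbT.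
  by rewrite ler_pdivlMr ?mulr_gt0 //; lra.
have etaB0 : 0 < eta * B by rewrite mulr_gt0.
have m00 : 0 < m 0 0 by apply: m_gt0.
(* A uniform error [d] costs [d] times the total mass in norm, that is half of the room
   [eta * B]. *)
pose d := eta * B / (2 * m 0 0).
have d0 : 0 < d by rewrite divr_gt0 // mulr_gt0.
have dE : d * m 0 0 = eta * B / 2 by rewrite /d; field; rewrite gt_eqF.
have [y [hy yb]] := level_approx (fun t => (1 - eta) * b t) d0.
have err : \sum_t w t * `|P N y t - (1 - eta) * b t| <= eta * B / 2.
  rewrite -dE -(total_mass N) mulr_sumr; apply: ler_sum => t _.
  by rewrite mulrC ler_pM2r.
have err2 : \sum_t w t * `|P N y t - b t| <= eta * B / 2 + eta * B.
  apply: (le_trans _ (lerD err (lexx (eta * B)))).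
  rewrite -[X in _ <= _ + eta * X]b1 mulr_sumr -big_split /=; apply: ler_sum => t _.
  rewrite [eta * _]mulrCA -mulrDr ler_pM2l //.
  have -> : P N y t - b t = (P N y t - (1 - eta) * b t) - eta * b t by ring.
  by apply: (le_trans (ler_normB _ _)); rewrite normrM (gtr0_norm eta0).
exists y; split.
- rewrite (normE y hy); apply: (@le_lt_trans _ _ ((1 - eta) * B + eta * B / 2)); last first.
    by rewrite -/B mulrBl mul1r; lra.
  apply: (le_trans _ (lerD (lexx ((1 - eta) * B)) err)).
  rewrite -[X in _ <= _ * X + _]b1 mulr_sumr -big_split /=; apply: ler_sum => t _.
  rewrite [(1 - eta) * (_ * _)]mulrCA -mulrDr ler_pM2l //.
  have := ler_normD (P N y t - (1 - eta) * b t) ((1 - eta) * b t).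
  have eta1 : 0 <= 1 - eta by lra.
  have n1 : `|(1 - eta) * b t| = (1 - eta) * `|b t| by rewrite normrM ger0_norm.
  by rewrite n1 subrK addrC.
- rewrite -/B (normE _ (in_levelB hu hy)).
  have : \sum_t w t * `|uu t - b t| <=
      \sum_t w t * `|P N (u - y) t| + \sum_t w t * `|P N y t - b t|.
    rewrite -big_split /=; apply: ler_sum => t _; rewrite -mulrDr ler_pM2l //.
    rewrite step_val_sub raddfB; apply: le_trans (ler_normD _ _).
    by rewrite addrA subrK.
  by lra.
move=> i; rewrite (dominated_level (fP i) hy) (dominated_level (fP i) hz).
have h1 := b2 i.
have h2 : `|\sum_(t < 2 ^ N) P N y t * f i (chi N t) - \sum_t b t * c i t| <= eta * B / 2 + eta * B.
  apply: le_trans err2; rewrite -sumrB; apply: (le_trans (ler_norm_sum _ _ _)).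
  apply: ler_sum => t _; rewrite -mulrBl normrM mulrC; apply: ler_wpM2r => //.
  exact: cw.
have := ler_normD (\sum_(t < 2 ^ N) P N y t * f i (chi N t) - \sum_t b t * c i t)
   (\sum_t b t * c i t - \sum_t zz t * c i t).
rewrite addrA subrK.
by lra.
Qed.
End SmallMasses.

(** A common source of both shapes: [u] and [z] are unrelated, as for Daugavet, and there are
    finitely many functionals, as for DD2P. The vector [u] may be 0, which an induction over partial
    sums requires. *)
Definition concentrated (mu : V -> RR) : Prop :=
  forall (u z : V) n (f : 'I_n -> V -> RR) e,
  z != 0 -> (forall i, dominated mu (f i)) -> 0 < e ->
  exists y, [/\ mu y < mu z, mu u + mu z - e < mu (u - y) & forall i, `|f i y - f i z| < e].

(** [f] splits the norm as [|f| + (mu - |f|)] with a subadditive remainder, so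
    that slices of the unit ball along [f] are small. *)
Definition peaked (mu : V -> RR) : Prop :=
  exists f, [/\ dominated mu f,
    forall eta, 0 < eta -> exists x, mu x <= 1 /\ 1 - eta < f x &
    forall y z, mu (y - z) - `|f y - f z| <= (mu y - `|f y|) + (mu z - `|f z|)].

Section Concentrated.
Variable mu : V -> RR.
Hypothesis muP : seminorm_V mu.
Hypothesis mu0 : forall v, mu v = 0 -> v = 0.
Hypothesis conc : concentrated mu.

Lemma mu_gt0 v : v != 0 -> 0 < mu v.
Proof.
by move=> v0; rewrite lt_neqAle (sn_ge0 muP) andbT eq_sym; apply: contra_neq v0; exact: mu0.
Qed.

Lemma concentrated_far n x z e : z != 0 -> 0 < e -> far_cond mu n x z e.
Proof.
move=> z0 e0 f fP; have [y [h1 h2 h3]] := conc x z0 fP e0.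
exists y; split=> // i; have := h3 i; rewrite ltr_norml => /andP[h4 _]; lra.
Qed.

(** The vectors are chosen one after another, each almost additive in norm with the partial sum
    already built. *)
Lemma concentrated_sum (K : nat) (l : nat -> rat) (z : nat -> V) (f : nat -> V -> RR) u0 e :
  (forall k, 0 < l k) -> (forall k, z k != 0) -> (forall k, dominated mu (f k)) -> 0 < e ->
  exists y : nat -> V, (forall k, (k < K)%N -> mu (y k) < mu (z k) /\ f k (z k) - e < f k (y k)) /\
    mu u0 + \sum_(k < K) ratr (l k) * mu (z k) - K%:R * e <= mu (u0 + \sum_(k < K) l k *: y k).
Proof.
move=> l0 z0 fP e0; elim: K => [|K [y [y1 y2]]].
  by exists z; split => //; rewrite !big_ord0 !addr0 mul0r subr0.
have lK0 : 0 < ratr (l K) :> RR by rewrite ltr0q.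
(* The tolerance serves twice: directly in the norm estimate, and divided by [l K] in the functional
   one. [concentrated] speaks of differences, so it is applied to [- l K *: z K] and the sign is
   undone in [v]. *)
pose e' := e * Num.min 1 (ratr (l K)).
have e'0 : 0 < e' by rewrite mulr_gt0 // lt_min ltr01.
have e'e : e' <= e by rewrite -[leRHS]mulr1 ler_pM2l // ge_min lexx.
have e'l : e' <= e * ratr (l K) by rewrite ler_pM2l // ge_min lexx orbT.
have zl0 : - l K *: z K != 0 by rewrite scaler_eq0 oppr_eq0 gt_eqF //= (negbTE (z0 K)).
have mzl : mu (- l K *: z K) = ratr (l K) * mu (z K).
  by rewrite scaleNr (snN muP) (snZ muP) gtr0_norm.
have [y' [h1 h2 /(_ ord0) h3]] := conc (u0 + \sum_(k < K) l k *: y k) zl0 (fun _ : 'I_1 => fP K) e'0.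
rewrite mzl in h1 h2.
pose v := - (l K)^-1 *: y'.
have lv : l K *: v = - y' by rewrite /v scalerA mulrN mulfV ?gt_eqF // scaleN1r.
exists (fun k => if k == K then v else y k); split.
  move=> k; rewrite ltnS leq_eqVlt => /orP[/eqP ->|kK]; last first.
    by rewrite (ltn_eqF kK); exact: y1.
  rewrite eqxx; split.
    by rewrite -(ltr_pM2l lK0) -[in ltLHS](gtr0_norm lK0) -(snZ muP) lv (snN muP).
  have := h3; rewrite ltr_norml => /andP[_ h4].
  rewrite -(ltr_pM2l lK0) -(domZ (fP K)) lv (domN (fP K)).
  by move: h4; rewrite scaleNr (domN (fP K)) (domZ (fP K)) mulrBr (mulrC _ e); lra.
rewrite !big_ord_recr /= eqxx lv -natr1 mulrDl mul1r.
have -> : \sum_(i < K) l i *: (if i == K :> nat then v else y i) = \sum_(k < K) l k *: y k.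
  by apply: eq_bigr => i _; rewrite ltn_eqF.
by rewrite [u0 + (_ - _)]addrA; lra.
Qed.

Lemma unit_multiple v d : v != 0 -> 0 < d -> exists q : rat, 0 < q /\ 1 - d < ratr q * mu v <= 1.
Proof.
move=> v0 d0; have v1 := mu_gt0 v0.
pose t := Num.max (1 - d) (1 / 2).
have t0 : 0 < t by rewrite lt_max; apply/orP; right; lra.
have t1 : t < 1 by rewrite gt_max; apply/andP; split; lra.
have td : 1 - d <= t by rewrite le_max lexx.
have lt : t / mu v < 1 / mu v by rewrite ltr_pM2r ?invr_gt0.
have [q /=] := rat_in_itvoo lt; rewrite in_itv /= => /andP[h1 h2]; exists q.
have q0 : 0 < ratr q :> RR by apply: lt_trans h1; rewrite divr_gt0.
rewrite ltr0q in q0; split => //.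
by move: h1 h2; rewrite ltr_pdivrMr // ltr_pdivlMr // => h1 h2; apply/andP; split; lra.
Qed.

(** Norms add up to 2 only for vectors of norm almost 1. When [f x > 0], scaling [x] up increases
    [f]; otherwise any almost unit vector works, up to its sign. *)
Lemma unit_above x f d : mu x <= 1 -> dominated mu f -> 0 < d ->
  exists z, [/\ 1 - d < mu z, mu z <= 1 & f x <= f z].
Proof.
move=> x1 fP d0; have [fx|fx] := leP (f x) 0.
  pose e0 := fs_delta rat 0 : V.
  have e00 : e0 != 0.
    by apply/eqP => /(congr1 (fun v : V => proj1_sig v 0%N)) /= /eqP; rewrite oner_eq0.
  have [q [q0 /andP[h1 h2]]] := unit_multiple e00 d0.
  have muq : mu (q *: e0) = ratr q * mu e0 by rewrite (snZ muP) gtr0_norm // ltr0q.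
  have [fe|fe] := leP 0 (f (q *: e0)); first by exists (q *: e0); rewrite muq h1 h2; split => //; lra.
  by exists (- (q *: e0)); rewrite (snN muP) muq h1 h2 (domN fP); split => //; lra.
have [xd|xd] := ltP (1 - d) (mu x); first by exists x.
have x0 : x != 0 by apply/eqP => xE; move: fx; rewrite xE (dom0 fP) ltxx.
have [q [q0 /andP[h1 h2]]] := unit_multiple x0 d0.
have q1 : 1 < ratr q :> RR by rewrite -(ltr_pM2r (mu_gt0 x0)) mul1r; lra.
exists (q *: x); rewrite (snZ muP) gtr0_norm ?ltr0q // (domZ fP); split => //.
by rewrite -[leLHS]mul1r ler_pM2r // ltW.
Qed.

(** [concentrated_sum] is used twice: for [z] and [f] it gives [y]; for [- z] and [- f], starting
    from the sum already built, it gives [w]. Then [- w] satisfies the same slice conditions as [y],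
    and the difference of the two combinations is a sum of almost full norm. *)
Lemma concentrated_ccs n (lam : 'I_n.+1 -> rat) x e :
  (forall i, 0 < lam i) -> 0 < e -> ccs_cond mu lam x e.
Proof.
move=> lam0 e0.
have [hx|hx] := pselect (exists i, 1 < mu (x i)); [by left|right=> f fP].
have x1 i : mu (x i) <= 1 by rewrite leNgt; apply/negP => hi; apply: hx; exists i.
pose L : RR := \sum_i ratr (lam i).
have L0 : 0 < L.
  by rewrite /L big_ord_recl ltr_pwDl ?ltr0q // sumr_ge0 // => i _; rewrite ler0q ltW.
pose d := Num.min (1/2) (e / (4 * L)).
have d0 : 0 < d by rewrite lt_min; apply/andP; split; [lra|rewrite divr_gt0 // mulr_gt0].
have dL : d * L <= e / 4.
  have : d <= e / (4 * L) by rewrite ge_min lexx orbT.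
  by rewrite ler_pdivlMr ?mulr_gt0 //; lra.
have d1 : d <= 1/2 by rewrite ge_min lexx.
have /choice[z hz] : forall i, exists z, [/\ 1 - d < mu z, mu z <= 1 & f i (x i) <= f i z].
  by move=> i; exact: unit_above.
have z0 i : z i != 0.
  by apply/eqP => zE; have [h _ _] := hz i; move: h; rewrite zE (sn0 muP); lra.
(* The two uses lose [2 * n.+1 * e1], less than [e / 2], and replacing norms by 1 loses
   [2 * d * L <= e / 2]. *)
pose e1 := e / (4 * n.+1%:R + 2).
have n0 : 0 < n.+1%:R :> RR by rewrite ltr0n.
have C0 : 0 < 4 * n.+1%:R + 2 :> RR by lra.
have e10 : 0 < e1 by rewrite divr_gt0.
have e1E : 4 * (n.+1%:R * e1) + 2 * e1 = e by rewrite /e1; field; rewrite gt_eqF.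
have ne1 : 0 < n.+1%:R * e1 by rewrite mulr_gt0.
pose l k := lam (inord k : 'I_n.+1).
have l0 k : 0 < l k by exact: lam0.
have [y [y1 y2]] := @concentrated_sum n.+1 l (fun k => z (inord k)) (fun k => f (inord k)) 0 e1
  l0 (fun k => z0 _) (fun k => fP _) e10.
have Nz0 k : - z (inord k) != 0 by rewrite oppr_eq0 z0.
have [w [w1 w2]] := @concentrated_sum n.+1 l (fun k => - z (inord k)) (fun k v => - f (inord k) v)
  (\sum_(k < n.+1) l k *: y k) e1 l0 Nz0 (fun k => domN_dominated (fP _)) e10.
exists (fun i => y i), (fun i => - w i); split.
- by move=> i; have [] := y1 i (ltn_ord i); rewrite inord_val; have [_ h _] := hz i; lra.
- move=> i; have [] := w1 i (ltn_ord i); rewrite !(snN muP) inord_val.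
  by have [_ h _] := hz i; lra.
- move=> i; have [_] := y1 i (ltn_ord i); have [_] := w1 i (ltn_ord i).
  rewrite inord_val !(domN (fP i)) => h1 h2; have [_ _ h3] := hz i.
  by lra.
have -> : \sum_i lam i *: (y i - - w i) = \sum_(k < n.+1) l k *: y k + \sum_(k < n.+1) l k *: w k.
  by rewrite -big_split /=; apply: eq_bigr => i _; rewrite opprK scalerDr /l inord_val.
have hs : (1 - d) * L <= \sum_(k < n.+1) ratr (l k) * mu (z (inord k)).
  rewrite mulr_sumr; apply: ler_sum => i _; rewrite /l inord_val mulrC ler_pM2l ?ltr0q //.
  by have [h _ _] := hz i; exact: ltW.
rewrite (sn0 muP) !add0r in y2.
have sN : \sum_(k < n.+1) ratr (l k) * mu (- z (inord k)) = \sum_(k < n.+1) ratr (l k) * mu (z (inord k)).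
  by apply: eq_bigr => k _; rewrite (snN muP).
rewrite sN in w2.
rewrite -/L; move: hs; rewrite mulrBl mul1r.
by lra.
Qed.
End Concentrated.

(** Vectors of the ball whose values under [f] add up to more than [3/2] differ by at most [1/2] in
    value and leave remainders of total less than [1/2]. Their distance is below 1, whereas [7/4] is
    required. *)
Lemma peaked_ccs mu (lam : 'I_1 -> rat) : seminorm_V mu -> peaked mu -> lam ord0 = 1 ->
  exists x e, 0 < e /\ ~ ccs_cond mu lam x e.
Proof.
move=> muP [f [fP fpeak fsplit]] l1.
have [|x [x1 fx]] := fpeak (1/8); first by lra.
exists (fun=> x), (1/4); split; first by lra.
case=> [[_]|H]; first by lra.
have [y [z [/(_ ord0) y1 /(_ ord0) z1 /(_ ord0) yz]]] := H (fun=> f) (fun=> fP).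
rewrite !big_ord_recl !big_ord0 !addr0 l1 scale1r rmorph1 => hyz.
have := fsplit (y ord0) (z ord0).
have h1 := dom_le muP fP (y ord0); have h2 := dom_le muP fP (z ord0).
have h3 := ler_norm (f (y ord0)); have h4 := ler_norm (f (z ord0)).
have : `|f (y ord0) - f (z ord0)| <= 1/2 by rewrite ler_norml; apply/andP; split; lra.
by lra.
Qed.

(** The failure occurs for one functional and at [z = x], so it contradicts the condition for either
    value of [diag]. *)
Lemma peaked_far mu : seminorm_V mu -> peaked mu ->
  exists x e, [/\ x != 0, 0 < e & ~ far_cond mu 1 x x e].
Proof.
move=> muP [f [fP fpeak fsplit]].
have [|x [x1 fx]] := fpeak (1/8); first by lra.
exists x, (1/4); split; [|by lra|move=> H].
  by apply/eqP => xE; move: fx; rewrite xE (dom0 fP); lra.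
have [y [h1 h2 /(_ ord0) h3]] := H (fun=> f) (fun=> fP).
have := fsplit x y.
have h4 := dom_le muP fP x; have h5 := dom_le muP fP y.
have h6 := ler_norm (f x); have h7 := ler_norm (f y).
have : `|f x - f y| <= 3/8 by rewrite ler_norml; apply/andP; split; lra.
by lra.
Qed.

(** [f] integrates over the atom at 0, the coordinate 0 being the value there. The space splits as
    an [L_1] sum of the atom and the rest, so [mu - |f|] is the [L_1] seminorm of the measure
    without its atom, hence subadditive. Normalized indicators of small classes of 0 almost attain
    the norm of [f]. *)
Lemma atom_peaked m om :
  (forall N r, (r < 2 ^ N)%N -> 0 < m N r) ->
  (forall N r, (r < 2 ^ N)%N -> m N r = m N.+1 r + m N.+1 (r + 2 ^ N)%N) ->
  0 < om -> (forall N, om <= m N 0%N) ->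
  (forall d, 0 < d -> exists N, m N 0%N < om + d) -> peaked (step_norm m).
Proof.
move=> m_gt0 m_add om0 omm omlim; have muP := step_norm_seminorm m_gt0 m_add.
pose P N v r : RR := ratr (step_val N v r).
pose f (v : V) : RR := om * ratr (proj1_sig v 0%N).
have fP0 N v : `|f v| = om * `|P N v 0%N|.
  by rewrite /P step_val0 /f normrM gtr0_norm.
pose w N r := if r == 0%N then m N r - om else m N r.
have w0 N r : (r < 2 ^ N)%N -> 0 <= w N r.
  by rewrite /w; case: eqP => [-> _|_ /m_gt0/ltW //]; rewrite subr_ge0.
have split_norm N v : in_level N v ->
    step_norm m v - `|f v| = \sum_(r < 2 ^ N) w N r * `|P N v r|.
  move=> hv; rewrite (step_normE m_add hv) /level_norm (fP0 N).
  have z0 : (0 < 2 ^ N)%N by rewrite expn_gt0.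
  rewrite (bigD1 (Ordinal z0)) //= [RHS](bigD1 (Ordinal z0)) //=.
  rewrite {1}/w eqxx mulrBl addrAC; congr (_ + _).
  apply: eq_bigr => i i0; rewrite /w ifF //.
  by apply: contraNF i0 => /eqP i0; apply/eqP/val_inj.
exists f; split.
- split=> [q x y|x].
    by rewrite /f V_linE ratrD ratrM; ring.
  have [N hx] := in_level_exists x.
  rewrite (ger0_norm (sn_ge0 muP x)) -subr_ge0 (split_norm N) //.
  by apply: sumr_ge0 => -[r hr] _; rewrite mulr_ge0 // w0.
- move=> eta eta0; pose d := om * Num.min (1/2) (eta / 2).
  have d0 : 0 < d by rewrite mulr_gt0 // lt_min; apply/andP; split; lra.
  have dle : d <= om * (eta / 2) by rewrite ler_pM2l // ge_min lexx orbT.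
  have [N hN] := omlim d d0.
  pose x := step_of N (fun r => (r == 0%N)%:R).
  have xm : step_norm m x = m N 0%N by apply: chi_norm => //; rewrite expn_gt0.
  have mN0 : 0 < m N 0%N by apply: m_gt0; rewrite expn_gt0.
  have x0 : x != 0 by apply/eqP => xE; move: mN0; rewrite -xm xE (sn0 muP) ltxx.
  have mu0 v : step_norm m v = 0 -> v = 0 by exact: (Bset_norm (step_norm_Bset m_gt0 m_add)).
  have eta2 : 0 < eta / 2 by lra.
  have [q [q0 /andP[h1 h2]]] := unit_multiple muP mu0 x0 eta2; rewrite xm in h1 h2.
  have rq0 : 0 < ratr q :> RR by rewrite ltr0q.
  exists (q *: x); split; first by rewrite (snZ muP) xm gtr0_norm.
  have -> : f (q *: x) = ratr q * om.
    rewrite /f V_scaleE ratrM; have -> : proj1_sig x 0%N = 1 by rewrite /= expn_gt0.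
    by rewrite rmorph1; ring.
  have h3 : ratr q * m N 0%N < ratr q * (om + d) by rewrite ltr_pM2l.
  have h4 : ratr q * d <= ratr q * om * (eta / 2) by rewrite -mulrA ler_pM2l.
  have h5 : ratr q * om <= 1.
    by apply: le_trans h2; rewrite ler_pM2l.
  have h6 : ratr q * om * (eta / 2) <= 1 * (eta / 2) by rewrite ler_pM2r.
  by move: h1 h3 h4 h6; rewrite mulrDr; lra.
move=> y z; have [N [hy hz _]] := in_level_exists2 y z 0.
have -> : f y - f z = f (y - z).
  rewrite /f; have -> : proj1_sig (y - z) 0%N = proj1_sig y 0%N - proj1_sig z 0%N by [].
  by rewrite raddfB /=; ring.
rewrite !(split_norm N) //; last exact: in_levelB.
rewrite -big_split; apply: ler_sum => -[r hr] _ /=.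
rewrite -mulrDr ler_wpM2l ?w0 // /P step_val_sub raddfB.
exact: ler_normB.
Qed.

(** * The reduction *)

Section BranchWeights.
Variable w : nat -> RR.
Hypothesis w_gt0 : forall N, 0 < w N.
Hypothesis w_decr : forall N, w N.+1 < w N.

(** All the mass [w N] of the class of [0] mod [2 ^ N] survives along the
    branch of [0]; off this branch the mass is split evenly. *)
Fixpoint branch_weight (N r : nat) : RR :=
  if N is k.+1 then
    if r == 0%N then w k.+1
    else if r == (2 ^ k)%N then w k - w k.+1
    else (if (r < 2 ^ k)%N then branch_weight k r else branch_weight k (r - 2 ^ k)%N) / 2
  else w 0%N.

Lemma branch_weight0 N : branch_weight N 0 = w N.
Proof. by case: N. Qed.

Lemma branch_weight_gt0 N r : (r < 2 ^ N)%N -> 0 < branch_weight N r.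
Proof.
elim: N r => [|N IH] r hr /=; first exact: w_gt0.
case: eqP => [_|_]; first exact: w_gt0.
case: eqP => [_|_]; first by rewrite subr_gt0.
have [rN|Nr] := ltnP r (2 ^ N); first by rewrite divr_gt0 // IH.
by rewrite divr_gt0 // IH // ltn_subLR // addnn -mul2n -expnS.
Qed.

Lemma branch_weight_add N r : (r < 2 ^ N)%N ->
  branch_weight N r = branch_weight N.+1 r + branch_weight N.+1 (r + 2 ^ N)%N.
Proof.
move=> hr /=; have N0 : (0 < 2 ^ N)%N by rewrite expn_gt0.
have [->|r0] := eqVneq r 0%N.
  by rewrite add0n eqxx (gtn_eqF N0) branch_weight0; ring.
rewrite (ltn_eqF hr) hr addn_eq0 (negbTE r0) /= -[X in _ == X]add0n eqn_add2r (negbTE r0).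
by rewrite ltnNge leq_addl /= addnK; lra.
Qed.

Lemma branch_weight_small : (forall e, 0 < e -> exists N, w N < e) ->
  forall e, 0 < e -> exists N, forall r, (r < 2 ^ N)%N -> branch_weight N r < e.
Proof.
move=> wlim e e0; have [K hK] := wlim e e0.
pose S := \sum_(r < 2 ^ K) branch_weight K r.
have SK r : (r < 2 ^ K)%N -> branch_weight K r <= S.
  move=> hr; rewrite /S (bigD1 (Ordinal hr)) //= lerDl.
  by apply: sumr_ge0 => -[i hi] _; exact/ltW/branch_weight_gt0.
have w_le j : w (j + K)%N <= w K.
  by elim: j => //= j IH; rewrite addSn; exact: le_trans (ltW (w_decr _)) IH.
(* A class on the branch, or just leaving it, has mass at most [w K]; any other class has half the
   mass of its parent. *)
have key j r : (r < 2 ^ (j + K))%N -> branch_weight (j + K) r <= Num.max (w K) (S / 2 ^+ j).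
  elim: j r => [|j IH] r; first by rewrite add0n expr0 divr1 le_max => /SK ->; rewrite orbT.
  rewrite addSn => hr /=.
  case: eqP => [_|_]; first by rewrite le_max -addSn w_le.
  case: eqP => [_|_].
    rewrite le_max; apply/orP; left; apply: le_trans (w_le j).
    by rewrite gerBl ltW.
  have half x : x <= Num.max (w K) (S / 2 ^+ j) -> x / 2 <= Num.max (w K) (S / 2 ^+ j.+1).
    rewrite !le_max exprS invfM => /orP[h|h]; apply/orP; [left|right].
      by have := w_gt0 K; lra.
    by rewrite (mulrC 2^-1) mulrA ler_pM2r // invr_gt0.
  have [rN|Nr] := ltnP r (2 ^ (j + K)); first by apply/half/IH.
  by apply/half/IH; rewrite ltn_subLR // addnn -mul2n -expnS.
have [k hk] : exists k : nat, S / e < k%:R.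
  exists (Num.bound (S / e)); apply: archi_boundP; apply: divr_ge0; last exact: ltW.
  by apply: sumr_ge0 => -[i hi] _; exact/ltW/branch_weight_gt0.
exists (k + K)%N => r hr; apply: (le_lt_trans (key _ _ hr)).
rewrite gt_max hK /= ltr_pdivrMr ?exprn_gt0 // mulrC -ltr_pdivrMr //.
apply: (lt_trans hk); rewrite -natrX ltr_nat; exact: ltn_expl.
Qed.

Definition branch_norm : V -> RR := step_norm branch_weight.

Lemma branch_norm_Bset : Bset branch_norm.
Proof. exact: step_norm_Bset branch_weight_gt0 branch_weight_add. Qed.

Lemma branch_norm_concentrated : (forall e, 0 < e -> exists N, w N < e) ->
  concentrated branch_norm.
Proof.
move=> wlim u z n f e; apply: step_norm_concentrate.
- exact: branch_weight_gt0.
- exact: branch_weight_add.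
exact: branch_weight_small.
Qed.

Lemma branch_norm_peaked d : 0 < d -> (forall N, d <= w N) -> peaked branch_norm.
Proof.
(* The infimum is the mass of the atom: the classes of 0 shrink to the point 0 and their masses
   decrease. *)
move=> d0 wd; pose om := inf (range w).
have hw : has_inf (range w).
  by split; [exists (w 0%N); exists 0%N|exists d => _ [N _ <-]; exact: wd].
have domega : d <= om by apply: lb_le_inf; [case: hw|move=> _ [N _ <-]; exact: wd].
apply: (@atom_peaked _ om).
- exact: branch_weight_gt0.
- exact: branch_weight_add.
- exact: lt_le_trans domega.
- by move=> N; rewrite branch_weight0; apply: ge_inf; [case: hw|exists N].
move=> e e0; have [_ [N _ <-] hN] := inf_adherent e0 hw.
by exists N; rewrite branch_weight0.
Qed.
End BranchWeights.

Section Reduction.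
Variable Y : topologicalType.

Lemma branch_norm_continuous (w : nat -> Y -> RR) :
  (forall N, continuous (w N : Y -> RF)) ->
  continuous (fun y => branch_norm (fun N => w N y) : RV).
Proof.
move=> wc.
have bc N r : continuous (fun y => branch_weight (fun N => w N y) N r : RF).
  elim: N r => [|N IH] r; first exact: wc.
  rewrite /=; case: (r == 0%N); first exact: wc.
  case: (r == _); first by apply: cts_add; [exact: wc|apply: cts_opp; exact: wc].
  by apply: cts_mul; [case: (r < _)%N; exact: IH|exact: cts_cst].
have vc v : continuous (fun y => branch_norm (fun N => w N y) v : RF).
  rewrite /branch_norm /step_norm /level_norm; case: cid => N hN /=.
  by apply: cts_sum => i; apply: cts_mul; [exact: bc|exact: cts_cst].
move=> y; apply/cvg_sup => v A.
rewrite nbhsE => -[_ [[U Uo <-] Uy] UA].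
by apply: filterS UA _; apply: (vc v y U); exact: open_nbhs_nbhs.
Qed.

Lemma polish_distance (O : set Y) : polish Y -> open O ->
  exists g : Y -> RF, [/\ continuous g, forall y, 0 <= g y & forall y, O y <-> 0 < g y].
Proof.
move=> [d [d0 [dE [dC [dT [dO _]]]]]] Oo.
(* The distance to the complement is truncated at 1, so that the infimum is meaningful even when the
   complement is empty. *)
pose E y := [set t : RR | t = 1 \/ exists2 z, ~ O z & t = d y z].
have E0 y : lbound (E y) 0 by move=> t [->|[z _ ->]]; [exact: ler01|exact: d0].
have Ei y : has_inf (E y) by split; [exists 1; left|exists 0; exact: E0].
pose g y : RF := inf (E y).
have g0 y : 0 <= g y by apply: lb_le_inf; [case: (Ei y)|exact: E0].
have gle y y' : g y <= g y' + d y y'.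
  rewrite -lerBlDr; apply: lb_le_inf; first by case: (Ei y').
  move=> t [->|[z Oz ->]]; rewrite lerBlDr.
    apply: (@le_trans _ _ 1); last by rewrite lerDl.
    by apply: ge_inf; [case: (Ei y)|left].
  apply: (@le_trans _ _ (d y z)); last by rewrite addrC.
  by apply: ge_inf; [case: (Ei y)|right; exists z].
have ball_open y e : open [set z | d y z < e].
  apply/dO => z /= yz; exists (e - d y z); first by rewrite subr_gt0.
  by move=> x /= zx; have := dT y z x; lra.
exists g; split => //.
  move=> y; apply/cvgrPdist_lt => e e0.
  have : nbhs y [set z | d y z < e].
    apply: open_nbhs_nbhs; split; first exact: ball_open.
    by rewrite /= (_ : d y y = 0) //; exact/dE.
  apply: filterS => z /= yz.
  have h1 := gle y z; have h2 := gle z y; rewrite dC in h2.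
  by rewrite ltr_norml; apply/andP; split; lra.
move=> y; split=> [Oy|gy].
  have [e e0 he] := (dO O).1 Oo y Oy.
  apply: (@lt_le_trans _ _ (Num.min 1 e)); first by rewrite lt_min ltr01.
  apply: lb_le_inf; first by case: (Ei y).
  move=> t [->|[z Oz ->]]; first by rewrite ge_min lexx.
  rewrite ge_min; apply/orP; right; rewrite leNgt; apply/negP => yz.
  by apply: Oz; exact: he.
apply: contrapT => Oy; have : g y <= d y y.
  by apply: ge_inf; [case: (Ei y)|right; exists y].
rewrite (_ : d y y = 0); last exact/dE.
by rewrite leNgt gy.
Qed.

(** [G n] is a decreasing sequence of continuous functions, positive throughout on [C] and
    eventually 0 elsewhere. Summing truncations counts its positive terms: infinitely many on [C],
    at most [i] if [O i] misses the point. *)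
Lemma Gdelta_divergence (C : set Y) : polish Y -> Gdelta C ->
  exists h : nat -> Y -> RF, [/\ forall N, continuous (h N),
    forall N y, 0 <= h N y <= h N.+1 y,
    forall y, C y -> forall M, exists N, M < h N y &
    forall y, ~ C y -> exists M, forall N, h N y <= M].
Proof.
move=> Yp [ O Oo ->].
have /choice[g gP] : forall i, exists g : Y -> RF,
    [/\ continuous g, forall y, 0 <= g y & forall y, O i y <-> 0 < g y].
  by move=> i; exact: polish_distance.
pose G := fix G n y : RF := if n is k.+1 then Num.min (G k y) (g n y) else g 0%N y.
have Gc n : continuous (G n).
  elim: n => [|n IH]; first by have [gc _ _] := gP 0%N.
  have [gc _ _] := gP n.+1; exact: (cts_min IH gc).
have G0 n y : 0 <= G n y.
  elim: n => [|n IH] /=; first by case: (gP 0%N).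
  by rewrite le_min IH /=; case: (gP n.+1).
have Ggt n y : (forall i, O i y) -> 0 < G n y.
  move=> Oy; elim: n => [|n IH] /=; first by case: (gP 0%N) => _ _ /(_ y) [+ _]; exact.
  by rewrite lt_min IH /=; case: (gP n.+1) => _ _ /(_ y) [+ _]; exact.
have Gle n y : G n y <= g n y by case: n => //= n; rewrite ge_min lexx orbT.
have Ganti n k y : G (k + n)%N y <= G n y.
  by elim: k => //= k IH; rewrite ge_min IH.
(* The factor [N] grows together with the number of terms, so on [C] each term eventually equals 1;
   as [G] decreases in [n], the term of index [k] controls all earlier ones. *)
pose a N n y : RF := Num.min 1 (N%:R * G n y).
have a0 N n y : 0 <= a N n y by rewrite le_min ler01 mulr_ge0.
have a_mono N n y : a N n y <= a N.+1 n y.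
  rewrite /a le_min ge_min lexx /= ge_min; apply/orP; right.
  by rewrite ler_wpM2r // ler_nat.
exists (fun N y => \sum_(n < N) a N n y); split.
- move=> N; apply: cts_sum => i; apply: cts_min; first exact: cts_cst.
  by apply: cts_mul; [exact: cts_cst|exact: Gc].
- move=> N y; apply/andP; split; first by apply: sumr_ge0 => i _; exact: a0.
  rewrite [leRHS]big_ord_recr; apply: ler_wpDr; first exact: a0.
  by apply: ler_sum => i _; exact: a_mono.
- move=> y Cy M; have [k hk] : exists k : nat, M < k%:R.
    exists (Num.bound `|M|); apply: (le_lt_trans (ler_norm _)).
    exact: archi_boundP.
  have Gk : 0 < G k y by apply: Ggt => i; exact: Cy.
  pose N := maxn k (Num.bound (G k y)^-1).
  have kN : (k <= N)%N by exact: leq_maxl.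
  have NG : 1 <= N%:R * G k y.
    rewrite -ler_pdivrMr // div1r; apply: ltW.
    apply: (lt_le_trans (archi_boundP _)); first by rewrite invr_ge0.
    by rewrite ler_nat leq_maxr.
  have a1 n : (n < k)%N -> a N n y = 1.
    move=> nk; apply/eqP; rewrite eq_le ge_min lexx /= le_min lexx /=.
    apply: (le_trans NG); rewrite ler_wpM2l //.
    by have := Ganti n (k - n)%N y; rewrite subnK // ltnW.
  exists N; apply: (lt_le_trans hk).
  rewrite -(big_mkord xpredT (fun n => a N n y)) (big_cat_nat _ (n := k)) //= -[leLHS]addr0.
  apply: lerD; last by apply: sumr_ge0 => i _; exact: a0.
  rewrite big_mkord (eq_bigr (fun=> 1)); first by rewrite sumr_const card_ord.
  by move=> i _; exact: a1.
move=> y nC; have [i Oi] : exists i, ~ O i y.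
  by apply: contrapT => h; apply: nC => i _; apply: contrapT => Oi; apply: h; exists i.
have gi : g i y = 0.
  have [_ gi0 giO] := gP i; apply/eqP; rewrite eq_le gi0 andbT leNgt.
  by apply/negP => h; exact: Oi ((giO y).2 h).
have Gz n : (i <= n)%N -> G n y = 0.
  move=> /subnK <-; apply/eqP; rewrite eq_le G0 andbT -gi.
  by apply: le_trans (Gle i y); exact: Ganti.
exists i%:R => N.
apply: (@le_trans _ _ (\sum_(n < N) (if (n < i)%N then 1 else 0))).
  apply: ler_sum => n _; case: ltnP => hn; first by rewrite ge_min lexx.
  by rewrite /a Gz // mulr0 ge_min lexx orbT.
have -> : \sum_(n < N) (if (n < i)%N then 1 else 0) = (\sum_(n < N) (n < i))%:R :> RF.
  by rewrite natr_sum; apply: eq_bigr => n _; case: ifP.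
rewrite ler_nat; elim: N => [|N IH]; first by rewrite big_ord0.
rewrite big_ord_recr /=; case: (ltnP N i) => hN; last by rewrite addn0.
rewrite addn1; apply: leq_ltn_trans hN.
rewrite -[leqRHS](card_ord N) -sum1_card; apply: leq_sum => n _; exact: leq_b1.
Qed.

Lemma reduction (C : set Y) : polish Y -> Gdelta C ->
  exists f : Y -> RV, [/\ continuous f, forall y, Bset (f y),
    forall y, C y -> concentrated (f y) & forall y, ~ C y -> peaked (f y)].
Proof.
move=> Yp Cg; have [h [hc hmono hC hnC]] := Gdelta_divergence Yp Cg.
(* [h] is only weakly increasing; subtracting [N.+1%:R^-1] makes [D] strictly increasing, so that
   classes leaving the branch have positive mass. The constant 2 keeps [D] at least 1. *)
pose D N y : RF := 2 + h N y - N.+1%:R^-1.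
have Dge N y : 1 + h N y <= D N y.
  have aux (s t : RR) : t <= 1 -> 1 + s <= 2 + s - t by lra.
  by apply: aux; rewrite invf_le1 ?ltr0n // ler1n.
have h0 N y : 0 <= h N y by have /andP[] := hmono N y.
have D0 N y : 0 < D N y by have := Dge N y; have := h0 N y; lra.
have Dincr N y : D N y < D N.+1 y.
  have /andP[_ h1] := hmono N y.
  have aux (s s' t t' : RR) : s <= s' -> t' < t -> 2 + s - t < 2 + s' - t' by lra.
  by apply: aux => //; rewrite ltf_pV2 ?posrE ?ltr0n // ltr_nat.
pose w N y : RF := (D N y)^-1.
have w0 y N : 0 < w N y by rewrite invr_gt0.
have wdecr y N : w N.+1 y < w N y by rewrite ltf_pV2 ?posrE.
exists (fun y => branch_norm (fun N => w N y)); split.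
- apply: branch_norm_continuous => N; apply: cts_inv; last by move=> y; rewrite gt_eqF.
  apply: cts_add; last exact: cts_cst.
  by apply: cts_add; [exact: cts_cst|exact: hc].
- by move=> y; exact: branch_norm_Bset.
- move=> y Cy; apply: branch_norm_concentrated => // e e0.
  have [N hN] := hC y Cy e^-1; exists N.
  rewrite -[ltRHS]invrK ltf_pV2 ?posrE ?invr_gt0 //.
  by apply: (lt_le_trans hN); have := Dge N y; lra.
move=> y nCy; have [M hM] := hnC y nCy.
have M0 : 0 <= M by apply: le_trans (hM 0%N).
have M2 : 0 < 2 + M by lra.
apply: (@branch_norm_peaked _ _ _ (2 + M)^-1) => //; first by rewrite invr_gt0.
move=> N; rewrite lef_pV2 ?posrE //.
have aux (s t : RR) : s <= M -> 0 < t -> 2 + s - t <= 2 + M by lra.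
by apply: aux; rewrite ?invr_gt0 ?ltr0n.
Qed.
End Reduction.

(** * Completeness of the five classes *)

Lemma class_complete (Pr : normedModType RR -> Prop) :
  (exists G : set RV, Gdelta G /\ iso_class Pr = Bset `&` G) ->
  (forall mu, Bset mu -> concentrated mu -> X_has mu Pr) ->
  (forall mu, Bset mu -> peaked mu -> ~ X_has mu Pr) ->
  Gdelta_complete Bset (iso_class Pr).
Proof.
move=> [G [GG PrE]] hconc hpeak; split; first by exists G.
move=> Y Yp _ C Cg; have [f [fc fB fC fnC]] := reduction Yp Cg.
exists f; split=> //; split=> //; apply/seteqP; split=> y.
  by move=> Cy; split; [exact: fB|exact: hconc (fB y) (fC y Cy)].
move=> [_ Xy]; apply: contrapT => nCy.
exact: hpeak (fB y) (fnC y nCy) Xy.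
Qed.

Lemma X_has_far (Pr : normedModType RR -> Prop) diag (N : nat -> bool) mu :
  (forall X, Pr X <-> forall n, N n -> far_property X diag n) -> Bset mu ->
  X_has mu Pr <-> forall n, N n -> forall x z : V, x != 0 -> z != 0 -> (diag -> x = z) ->
    forall e, 0 < e -> far_cond mu n x z e.
Proof.
move=> PrE muB; apply: X_hasP; first exact: Bset_Pset.
move=> X j jP; rewrite PrE.
have h n := far_model diag n jP (fun v => Bset_norm (v := v) muB).
by split=> H n /H /h.
Qed.

Lemma X_has_ccs (Pr : normedModType RR -> Prop) (N : nat -> bool) mu :
  (forall X, Pr X <-> forall n, N n -> ccs_property X n) -> Bset mu ->
  X_has mu Pr <-> forall n, N n -> forall lam x e, (forall i, 0 < lam i) -> 0 < e ->
    @ccs_cond mu n lam x e.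
Proof.
move=> PrE muB; apply: X_hasP; first exact: Bset_Pset.
move=> X j jP; rewrite PrE.
have h n := ccs_model n jP (model_dual_sphere jP (fun v => Bset_norm (v := v) muB)).
by split=> H n /H /h.
Qed.

Lemma far_class_complete (Pr : normedModType RR -> Prop) diag (N : nat -> bool) :
  (forall X, Pr X <-> forall n, N n -> far_property X diag n) -> N 1%N ->
  Gdelta_complete Bset (iso_class Pr).
Proof.
move=> PrE N1; apply: class_complete; first exact: far_class_Gdelta PrE.
  move=> mu muB conc; apply/(X_has_far PrE muB) => n _ x z x0 z0 _ e e0.
  exact: concentrated_far.
move=> mu muB peak /(X_has_far PrE muB)/(_ 1%N N1) H.
have [x [e [x0 e0]]] := peaked_far (Bset_Pset muB) peak.
by apply; exact: H.
Qed.

Lemma ccs_class_complete (Pr : normedModType RR -> Prop) (N : nat -> bool) :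
  (forall X, Pr X <-> forall n, N n -> ccs_property X n) -> N 0%N ->
  Gdelta_complete Bset (iso_class Pr).
Proof.
move=> PrE N0; apply: class_complete; first exact: ccs_class_Gdelta PrE.
  move=> mu muB conc; apply/(X_has_ccs PrE muB) => n _ lam x e lam0 e0.
  by apply: concentrated_ccs => //; [exact: Bset_Pset|move=> v; exact: Bset_norm].
move=> mu muB peak /(X_has_ccs PrE muB)/(_ 0%N N0) H.
have [x [e [e0]]] := @peaked_ccs mu (fun=> 1) (Bset_Pset muB) peak erefl.
by apply; exact: H.
Qed.

Theorem theorem4p3 :
  Gdelta_complete Bset (iso_class LD2P) /\
  Gdelta_complete Bset (iso_class SD2P) /\
  Gdelta_complete Bset (iso_class DLD2P) /\
  Gdelta_complete Bset (iso_class DD2P) /\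
  Gdelta_complete Bset (iso_class Daugavet).
Proof.
have one (Q : nat -> Prop) n : (forall m, m == n -> Q m) <-> Q n.
  by split=> [|Qn m /eqP ->] //; exact.
have all (Q : nat -> Prop) : (forall m, xpredT m -> Q m) <-> forall m, Q m.
  by split=> h m; [exact: h|move=> _; exact: h].
split; first by apply: (@ccs_class_complete _ (pred1 0%N)) => // X; rewrite LD2P_ccs one.
split; first by apply: (@ccs_class_complete _ xpredT) => // X; rewrite SD2P_ccs all.
split; first by apply: (@far_class_complete _ true (pred1 1%N)) => // X; rewrite DLD2P_far one.
split; first by apply: (@far_class_complete _ true xpredT) => // X; rewrite DD2P_far all.
by apply: (@far_class_complete _ false (pred1 1%N)) => // X; rewrite Daugavet_far one.
Qed.
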